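(* Let $s\in(0,1)$ and let $\Omega\subseteq\mathbb{R}^n$ be a bounded open set with boundary of class $C^1$. Let $c_0\in\mathbb{R}$ and $\overline\varepsilon\in(0,1)$. Let $u\in C_b(\mathbb{R}^n)\cap C^2(\overline\Omega)$ be such that $\mathcal{L}u\ge0$ pointwise in $\Omega$. Let $\xi\in\partial\Omega$, and assume that $u=c_0$ on $B_{\overline\varepsilon}(\xi)\cap\partial\Omega$, that $u\ge c_0$ in $\mathbb{R}^n$, that $u\not\equiv c_0$, and that $B_{\overline\varepsilon}(\xi)\cap\partial\Omega$ is of class $C^2$. Let $\nu$ be the outer unit normal to $\partial\Omega$ at $\xi$. Then $\partial_\nu u(\xi)<0$.
   Context: $C_b(\mathbb{R}^n):=C(\mathbb{R}^n)\cap L^\infty(\mathbb{R}^n)$. The operator is $\mathcal{L}=-\Delta+(-\Delta)^s$, computed pointwise, where $$(-\Delta)^s u(x):=\frac12\int_{\mathbb{R}^n}\frac{2u(x)-u(x+y)-u(x-y)}{|y|^{n+2s}}\,dy .$$ $B_r(\xi)$ denotes the open ball of radius $r$ centred at $\xi$. *)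

(* Defs.v *)
From HB Require Import structures.
From mathcomp Require Import all_boot all_order all_algebra.
From mathcomp Require Import all_classical all_reals all_analysis.
Set Implicit Arguments. Unset Strict Implicit. Unset Printing Implicit Defensive.
Import Order.TTheory GRing.Theory Num.Theory.
Import numFieldNormedType.Exports.
Local Open Scope classical_set_scope.
Local Open Scope ring_scope.

Section Defs.
Variable R : realType.
Variable n : nat.
Local Notation V := 'rV[R]_n.

Definition dotp (x y : V) : R := \sum_(i < n) x ord0 i * y ord0 i.
Definition enorm (x : V) : R := Num.sqrt (dotp x x).

Definition eball (xi : V) (r : R) : set V := [set x | enorm (x - xi) < r].

Definition ebasis (i : 'I_n) : V := delta_mx ord0 i.

Definition bdry (A : set V) : set V := closure A `\` A°.

Fixpoint Ck (k : nat) (f : V -> R) : Prop :=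
  match k with
  | 0 => continuous f
  | k'.+1 => continuous f /\
      forall i : 'I_n, (forall x, derivable f x (ebasis i)) /\
        Ck k' (fun x => 'D_(ebasis i) f x)
  end.

Definition grad (f : V -> R) (x : V) : V := \row_i ('D_(ebasis i) f x).

(** Local representation of the boundary of Omega near p as a C^k graph:
    there are r > 0, a unit direction e and a C^k function g which is
    constant along e (i.e. a C^k function on the hyperplane e^perp) such that
    Omega /\ B_r(p) = { x in B_r(p) : <x,e> > g x }. *)
Definition Ck_graph_at (k : nat) (Omega : set V) (p : V) (r : R) (e : V)
    (g : V -> R) : Prop :=
  0 < r /\ enorm e = 1 /\ Ck k g /\ (forall x t, g (x + t *: e) = g x) /\
  (forall x, eball p r x -> (Omega x <-> g x < dotp x e)).

Definition bdry_Ck_at (k : nat) (Omega : set V) (p : V) : Prop :=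
  exists r e g, Ck_graph_at k Omega p r e g.

Definition bdry_Ck (k : nat) (Omega : set V) : Prop :=
  forall p, bdry Omega p -> bdry_Ck_at k Omega p.

(** nu is the outer unit normal to bdry Omega at xi: with a local C^1 graph
    representation Omega = { g - <.,e> < 0 } near xi, nu is the normalized
    gradient of g - <.,e> at xi. *)
Definition outer_unit_normal (Omega : set V) (xi nu : V) : Prop :=
  exists r e g, Ck_graph_at 1 Omega xi r e g /\
    nu = (enorm (grad g xi - e))^-1 *: (grad g xi - e).

(** u in C^2(closure Omega): partial derivatives of order <= 2 exist in Omega
    and extend continuously to the closure; Du and D2u are these extensions. *)
Definition C2_closure (Omega : set V) (u : V -> R)
    (Du : 'I_n -> V -> R) (D2u : 'I_n -> 'I_n -> V -> R) : Prop :=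
  (forall i x, Omega x -> derivable u x (ebasis i) /\
                          'D_(ebasis i) u x = Du i x) /\
  (forall i j x, Omega x -> derivable (Du i) x (ebasis j) /\
                            'D_(ebasis j) (Du i) x = D2u i j x) /\
  (forall i, {within closure Omega, continuous (Du i)}) /\
  (forall i j, {within closure Omega, continuous (D2u i j)}).

(** Lebesgue integral over R^n, as an iterated one-dimensional Lebesgue
    integral (Fubini), integrating the coordinates one after another. *)
Definition upd (a : nat -> R) (m : nat) (t : R) : nat -> R :=
  fun j => if j == m then t else a j.

Fixpoint iint (m : nat) (g : (nat -> R) -> \bar R) (a : nat -> R) : \bar R :=
  match m with
  | 0 => g a
  | m'.+1 => (\int[lebesgue_measure]_(t in [set: R]) iint m' g (upd a m' t))%E
  end.

Definition integral_Rn (f : V -> R) : \bar R :=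
  iint n (fun a => (f (\row_i a (nat_of_ord i)))%:E) (fun _ => 0).

Definition fraclap (s : R) (u : V -> R) (x : V) : \bar R :=
  ((2^-1)%:E * integral_Rn (fun y =>
      ((2 * u x - u (x + y) - u (x - y)) / (enorm y `^ (n%:R + 2 * s)))%R))%E.

Definition laplacian (u : V -> R) (x : V) : R :=
  \sum_(i < n) 'D_(ebasis i) ('D_(ebasis i) u) x.

Definition mixedL (s : R) (u : V -> R) (x : V) : \bar R :=
  ((- laplacian u x)%:E + fraclap s u x)%E.

End Defs.

(* Main.v *)
(* Hopf's argument. Write w = u - c0 >= 0. At a zero of w inside Omega the
   Laplacian of u is nonnegative, while the nonlocal term is strictly negative
   because w is not identically zero on the whole space; hence w > 0 in Omega,
   without any connectedness. The C^2 boundary gives an interior ball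
   B_rho(x0) touching at xi. There w is compared with eps (exp(-alpha
   |x-x0|^2) - exp(-alpha rho^2)), which is nonpositive outside the ball and
   small on the half ball. At a negative minimum x of the difference, the
   Laplacian of the Gaussian f contributes f(x) alpha^2 rho^2 / 8 up to
   O(alpha), whereas 2 f(x) - f(x+y) - f(x-y) <= 2 f(x) (1 - exp(-alpha
   |y|^2)) bounds its fractional Laplacian by C alpha f(x): impossible for
   large alpha. So w grows linearly from xi along the inner normal.

   Only monotonicity of the iterated integral in the definition of the
   fractional Laplacian is needed: integrands are compared pointwise, never
   added, so no integrability of the integrand of u enters. *)

Require Import Defs.
From HB Require Import structures.
From mathcomp Require Import all_boot all_order all_algebra.
From mathcomp Require Import all_classical all_reals all_analysis.
From mathcomp Require Import measurable_realfun ring lra.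
Import Order.TTheory GRing.Theory Num.Theory.
Import numFieldNormedType.Exports.
Local Open Scope classical_set_scope.
Local Open Scope ring_scope.

(** * The iterated integral *)

Section unconditional_monotonicity.
Context d (T : measurableType d) (R : realType).
Variable mu : {measure set T -> \bar R}.
Local Open Scope ereal_scope.

(* The integral is a difference of suprema over simple functions, so it is
   monotone even for non-measurable or non-integrable integrands. *)
Lemma le_integral_pointwise (D : set T) (f g : T -> \bar R) :
  (forall x, f x <= g x) -> \int[mu]_(x in D) f x <= \int[mu]_(x in D) g x.
Proof.
move=> fg; rewrite /integral; apply: leeB.
- apply: le_ereal_sup => _ [h /= hf <-]; exists h => //= x.
  apply: (le_trans (hf x)); rewrite !funeposE /patch; case: ifP => // _.
  by rewrite ge_max !le_max fg lexx orbT.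
- apply: le_ereal_sup => _ [h /= hf <-]; exists h => //= x.
  apply: (le_trans (hf x)); rewrite !funenegE /patch; case: ifP => // _.
  by rewrite ge_max !le_max leeN2 fg lexx orbT.
Qed.

End unconditional_monotonicity.

Section iterated_integral.
Context {R : realType}.
Implicit Types (g h : (nat -> R) -> \bar R) (a p : nat -> R) (m : nat).

(** [iint m] overwrites only the coordinates below [m], so comparison is asked only at sequences
    that agree with [a] from [m] on. In an induction step this fixes the outer variable, and factors
    depending on it alone can be pulled out of the inner integral. *)
Lemma le_iint m g h a :
  (forall b, (forall j, (m <= j)%N -> b j = a j) -> (g b <= h b)%E) ->
  (iint m g a <= iint m h a)%E.
Proof.
elim: m a => [|m IH] a gh /=; first exact: gh.
apply: le_integral_pointwise => t; apply: IH => b hb; apply: gh => j mj.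
by rewrite hb ?(ltnW mj)// /upd gtn_eqF.
Qed.

Lemma eq_iint m g h a :
  (forall b, (forall j, (m <= j)%N -> b j = a j) -> g b = h b) ->
  iint m g a = iint m h a.
Proof. by move=> gh; apply/le_anti/andP; split; apply: le_iint => b /gh ->. Qed.

Definition box p (r : R) : nat -> set R := fun i => `[p i - r, p i + r]%classic.

Lemma lebesgue_measure_box p r i : 0 <= r ->
  lebesgue_measure (box p r i) = (2 * r)%:E.
Proof.
move=> r0; rewrite /box lebesgue_measure_itv /= lte_fin.
case: ltP => h; first by rewrite EFinN -EFinB; congr _%:E; ring.
have -> : r = 0 by lra.
by rewrite mulr0.
Qed.

(** Coordinate [m] is integrated outermost, so its indicator is a constant for the inner integral
    and is absorbed into [c]; hence the induction over all [c]. *)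
Lemma iint_box m c p r a : 0 <= r ->
  iint m (fun b => (c * \prod_(i < m) \1_(box p r i) (b i))%:E) a =
  (c * (2 * r) ^+ m)%:E.
Proof.
move=> r0; elim: m c a => [|m IH] c a /=; first by rewrite big_ord0 expr0.
under eq_integral => t _.
  rewrite (@eq_iint _ _ (fun b => ((c * \1_(box p r m) t) *
     \prod_(i < m) \1_(box p r i) (b i))%:E)); last first.
    move=> b hb; rewrite big_ord_recr /= (hb m)// /upd eqxx.
    by congr _%:E; ring.
  rewrite IH.
  have -> : (c * \1_(box p r m) t * (2 * r) ^+ m =
             c * (2 * r) ^+ m * \1_(box p r m) t) by ring.
  rewrite EFinM. over.
have mb : measurable (box p r m) by exact: measurable_itv.
rewrite integralZl//; last first.
  exact: integrable_indic_itv.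
rewrite integral_indic//= setIT; rewrite lebesgue_measure_box// -EFinM.
by congr _%:E; rewrite exprS; ring.
Qed.

(** Monotone convergence, applied once per coordinate: the weights absorb the indicator of the outer
    variable, and nonnegativity allows exchanging sum and integral. *)
Lemma iint_box_series m (c r : nat -> R) p a :
  (forall k, 0 <= c k) -> (forall k, 0 <= r k) ->
  iint m (fun b => (\sum_(0 <= k <oo)
     (c k * \prod_(i < m) \1_(box p (r k) i) (b i))%:E)%E) a =
  (\sum_(0 <= k <oo) (c k * (2 * r k) ^+ m)%:E)%E.
Proof.
move=> c0 r0; elim: m c c0 a => [|m IH] c c0 a /=.
  by apply: eq_eseriesr => k _; rewrite big_ord0 expr0.
under eq_integral => t _.
  rewrite (@eq_iint _ _ (fun b => (\sum_(0 <= k <oo) ((c k * \1_(box p (r k) m) t) *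
     \prod_(i < m) \1_(box p (r k) i) (b i))%:E)%E)); last first.
    move=> b hb; apply: eq_eseriesr => k _.
    rewrite big_ord_recr /= (hb m)// /upd eqxx.
    by congr _%:E; ring.
  rewrite (IH (fun k => c k * \1_(box p (r k) m) t)); last first.
    by move=> k; apply: mulr_ge0.
  over.
have mb k : measurable (box p (r k) m) by exact: measurable_itv.
rewrite integral_nneseries//=; last 2 first.
- move=> k; apply/measurable_EFinP; apply: measurable_funM => //.
  by apply: (@measurable_funM _ _ R setT (cst (c k))) => //; exact: measurable_indic (mb k).
- by move=> i t _; rewrite lee_fin !mulr_ge0// ?exprn_ge0// mulr_ge0.
apply: eq_eseriesr => k _.
under eq_integral => t _.
  have -> : (c k * \1_(box p (r k) m) t * (2 * r k) ^+ m =
             c k * (2 * r k) ^+ m * \1_(box p (r k) m) t) by ring.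
  rewrite EFinM. over.
rewrite integralZl//; last first.
  exact: integrable_indic_itv.
rewrite integral_indic//=; last exact: mb.
rewrite setIT; rewrite lebesgue_measure_box// -EFinM.
by congr _%:E; rewrite exprS; ring.
Qed.

End iterated_integral.

(** * Euclidean norm against sup norm *)

Section euclidean.
Context {R : realType} {n : nat}.
Implicit Types (x y z : 'rV[R]_n) (t : R).

Lemma dotpC x y : dotp x y = dotp y x.
Proof. by apply: eq_bigr => i _; rewrite mulrC. Qed.

Lemma dotpDl x y z : dotp (x + y) z = dotp x z + dotp y z.
Proof. by rewrite -big_split; apply: eq_bigr => i _; rewrite mxE mulrDl. Qed.

Lemma dotpZl t x y : dotp (t *: x) y = t * dotp x y.
Proof. by rewrite mulr_sumr; apply: eq_bigr => i _; rewrite mxE mulrA. Qed.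

Lemma dotpDr x y z : dotp x (y + z) = dotp x y + dotp x z.
Proof. by rewrite !(dotpC x) dotpDl. Qed.

Lemma dotpZr t x y : dotp x (t *: y) = t * dotp x y.
Proof. by rewrite !(dotpC x) dotpZl. Qed.

Lemma dotpNl x y : dotp (- x) y = - dotp x y.
Proof. by rewrite -scaleN1r dotpZl mulN1r. Qed.

Lemma dotpNr x y : dotp x (- y) = - dotp x y.
Proof. by rewrite dotpC dotpNl dotpC. Qed.

Definition dotp_simp := (dotpDl, dotpDr, dotpZl, dotpZr, dotpNl, dotpNr).

Lemma dotp_ge0 x : 0 <= dotp x x.
Proof. by apply: sumr_ge0 => i _; rewrite -expr2 sqr_ge0. Qed.

Lemma dotp_ebasis x i : dotp x (ebasis R i) = x ord0 i.
Proof.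
rewrite /dotp (bigD1 i)//= big1 => [|j ji]; rewrite /ebasis mxE !eqxx/=.
  by rewrite mulr1 addr0.
by rewrite (negbTE ji) mulr0.
Qed.

Lemma dotp_ebasis_self i : dotp (ebasis R i : 'rV_n) (ebasis R i) = 1.
Proof. by rewrite dotp_ebasis /ebasis mxE !eqxx. Qed.

Lemma dotp_eq0 x : dotp x x = 0 -> x = 0.
Proof.
move=> x0; apply/rowP => i; rewrite mxE; apply/eqP; rewrite -sqrf_eq0 expr2.
apply/eqP; move: i (erefl true); apply: psumr_eq0P x0 => i _.
by rewrite -expr2 sqr_ge0.
Qed.

Lemma enorm_ge0 x : 0 <= enorm x.
Proof. exact: sqrtr_ge0. Qed.

Lemma enorm_sqr x : enorm x ^+ 2 = dotp x x.
Proof. by rewrite sqr_sqrtr ?dotp_ge0. Qed.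

Lemma enorm0 : enorm (0 : 'rV[R]_n) = 0.
Proof. by rewrite /enorm /dotp big1 ?sqrtr0// => i _; rewrite mxE mulr0. Qed.

Lemma enorm_gt0 x : x != 0 -> 0 < enorm x.
Proof.
move=> x0; rewrite sqrtr_gt0 lt_def dotp_ge0 andbT.
by apply: contra x0 => /eqP/dotp_eq0/eqP.
Qed.

Lemma enormZ t x : enorm (t *: x) = `|t| * enorm x.
Proof. by rewrite /enorm dotpZl dotpZr mulrA -expr2 sqrtrM ?sqr_ge0// sqrtr_sqr. Qed.

Lemma enormN x : enorm (- x) = enorm x.
Proof. by rewrite -scaleN1r enormZ normrN1 mul1r. Qed.

Lemma dotp_le_enorm x y : dotp x y <= enorm x * enorm y.
Proof.
have [->|y0] := eqVneq y 0.
  by rewrite enorm0 mulr0 -(scale0r 0) dotpZr mul0r.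
have yy : 0 < dotp y y by rewrite -enorm_sqr exprn_gt0// enorm_gt0.
have [xy|xy] := leP (dotp x y) 0.
  by rewrite (le_trans xy)// mulr_ge0 ?enorm_ge0.
rewrite -(@ler_pXn2r _ 2)// ?nnegrE ?mulr_ge0 ?enorm_ge0 ?(ltW xy)//.
rewrite exprMn !enorm_sqr.
(* Cauchy-Schwarz: this vector is a multiple of the part of [x] orthogonal to [y]. *)
have := dotp_ge0 (dotp y y *: x - dotp x y *: y).
rewrite !dotp_simp (dotpC y x).
rewrite (_ : _ + _ = dotp y y * (dotp x x * dotp y y - dotp x y ^+ 2)); last by ring.
by rewrite pmulr_rge0// subr_ge0.
Qed.

Lemma coord_le_norm x i : `|x ord0 i| <= `|x|.
Proof.
rewrite /Num.norm/= mx_normrE.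
exact: (@le_bigmax _ _ _ _ (fun k : 'I_1 * 'I_n => `|x k.1 k.2|) (ord0, i)).
Qed.

Lemma coord_le_enorm x i : `|x ord0 i| <= enorm x.
Proof.
rewrite -sqrtr_sqr ler_wsqrtr// /dotp (bigD1 i)//= expr2 lerDl.
by apply: sumr_ge0 => j _; rewrite -expr2 sqr_ge0.
Qed.

Lemma norm_le_enorm x : `|x| <= enorm x.
Proof.
rewrite {1}/Num.norm/= mx_normrE; apply: bigmax_le; first exact: enorm_ge0.
by move=> [i j] _ /=; rewrite (ord1 i) coord_le_enorm.
Qed.

Lemma enorm_le_norm x : enorm x <= n%:R * `|x|.
Proof.
rewrite -(@ler_pXn2r _ 2)// ?nnegrE ?enorm_ge0 ?mulr_ge0//.
rewrite enorm_sqr.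
apply: (@le_trans _ _ (\sum_(i < n) `|x| ^+ 2)).
  apply: ler_sum => i _; rewrite -expr2 -real_normK ?num_real//.
  by rewrite lerXn2r ?nnegrE// coord_le_norm.
rewrite sumr_const card_ord exprMn -[leLHS]mulr_natl ler_wpM2r ?sqr_ge0//.
rewrite -natrX ler_nat; case: (n) => // k; exact: leq_pmulr.
Qed.

Lemma coord_continuous_rV i : continuous (fun x => x ord0 i).
Proof. exact: coord_continuous. Qed.

Lemma dotp_continuous (f g : 'rV[R]_n -> 'rV[R]_n) :
  continuous f -> continuous g -> continuous (fun x => dotp (f x) (g x)).
Proof.
move=> cf cg; apply: continuous_big => [|i _ x]; first exact: add_continuous.
have cc (h : 'rV[R]_n -> 'rV[R]_n) : continuous h -> continuous (fun y : 'rV[R]_n => h y ord0 i : R).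
  by move=> ch y; exact: (@continuous_comp _ _ _ h (fun y => y ord0 i) y (ch y) (coord_continuous_rV i (h y))).
by apply: continuousM; [exact: (cc f)|exact: (cc g)].
Qed.

Lemma enorm_continuous : continuous (@enorm R n).
Proof.
move=> x; apply: (@continuous_comp _ _ _ (fun y => dotp y y) Num.sqrt x); last exact: sqrt_continuous.
by apply: (@dotp_continuous id id) => y; exact: cvg_id.
Qed.

(** The topology on row vectors is that of the sup norm, so Euclidean balls are reached through
    continuity of [enorm]. *)
Lemma nbhs_eball x r : 0 < r -> nbhs x (eball x r).
Proof.
move=> r0; have c : continuous (fun y => enorm (y - x)).
  move=> y; apply: (@continuous_comp _ _ _ (fun y => y - x) (@enorm R n) y); last exact: enorm_continuous.
  by apply: continuousB; [exact: (fun _ => cvg_id)|exact: cst_continuous].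
have := c x; rewrite /eball.
by move=> /cvgr_lt/(_ r); apply; rewrite subrr enorm0.
Qed.

End euclidean.

(** * Integrability of the truncated kernel *)

Section kernel.
Context {R : realType}.

Lemma nneseries_le_geometric (c : nat -> R) (K q : R) :
  0 < q < 1 -> 0 <= K -> (forall k, 0 <= c k <= K * q ^+ k) ->
  (\sum_(0 <= k <oo) (c k)%:E <= (K / (1 - q))%:E)%E.
Proof.
move=> /andP[q0 q1] K0 cK; apply: lime_le.
  by apply: is_cvg_nneseries => k _ _; rewrite lee_fin; case/andP: (cK k).
apply: nearW => N; rewrite sumEFin lee_fin.
apply: (@le_trans _ _ (series (geometric K q) N)).
  by apply: ler_sum => k _; case/andP: (cK k).
by apply: geometric_le_lim => //; rewrite ger0_norm// ltW.
Qed.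

Lemma nneseries_ge_term (c : nat -> R) k :
  (forall k, 0 <= c k) -> ((c k)%:E <= \sum_(0 <= k <oo) (c k)%:E)%E.
Proof.
move=> c0; apply: (@le_trans _ _ (\sum_(0 <= i < k.+1) (c i)%:E)%E).
  rewrite big_nat_recr//= leeDr// sume_ge0// => i _; by rewrite lee_fin.
by apply: nneseries_lim_ge => i _ _; rewrite lee_fin.
Qed.

(** Base 4 because inner and outer annuli share one index, each family using every second [k]:
    successive radii differ by a factor 4. *)
Lemma exists_pow4 (x : R) : 1 <= x -> exists j, 4 ^+ j <= x <= 4 ^+ j.+1.
Proof.
move=> x1.
have ex : exists j, x < 4 ^+ j.+1.
  exists (Num.bound x).
  have /lt_le_trans := archi_boundP (le_trans ler01 x1).
  apply; rewrite -natrX ler_nat.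
  by apply: (leq_trans (leqnSn _)); apply: ltnW; exact: ltn_expl.
case: (ex_minnP ex) => j xj minj; exists j; rewrite (ltW xj) andbT.
case: j xj minj => [//|j] _ minj; rewrite leNgt; apply/negP => /minj.
by rewrite ltnn.
Qed.

Section majorant.
Variables (n : nat) (s : R).
Hypotheses (n0 : (0 < n)%N) (s01 : 0 < s < 1).

(** The kernel min(1, q^2) / q^p2 is at most q^-p1, by min(1, q^2) <= q^(1+s), and at most q^-p2. As
    p1 < n < p2, the first bound is integrable at the origin and the second at infinity. *)
Let p1 : R := n%:R - 1 + s.
Let p2 : R := n%:R + 2 * s.
Let b1 := 2 `^ p1.
Let b2 := 2 `^ p2.

Let s0 : 0 < s. Proof. by case/andP: s01. Qed.
Let s1 : s < 1. Proof. by case/andP: s01. Qed.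
Let n1 : 1 <= n%:R :> R. Proof. by rewrite ler1n. Qed.
Let p10 : 0 < p1. Proof. by rewrite /p1; move: n1 s0; lra. Qed.
Let p20 : 0 < p2. Proof. by rewrite /p2; move: n1 s0; lra. Qed.
Let b1_gt0 : 0 < b1. Proof. by rewrite powR_gt0. Qed.
Let b2_gt0 : 0 < b2. Proof. by rewrite powR_gt0. Qed.

Let pow2_lt x y : x < y -> 2 `^ x < 2 `^ y :> R.
Proof.
move=> xy; rewrite -[y](subrK x) powRD; last by rewrite pnatr_eq0 implybT.
rewrite ltr_pMl ?powR_gt0// -[ltLHS](powRr0 2).
by rewrite /powR pnatr_eq0/= ltr_expR ltr_pM2r ?subr_gt0// ln_gt0// ltr1n.
Qed.

Let b1_lt : b1 < 2 ^+ n.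
Proof. by rewrite -powR_mulrn//; apply: pow2_lt; rewrite /p1; move: s1; lra. Qed.

Let b2_gt : 2 ^+ n < b2.
Proof. by rewrite -powR_mulrn//; apply: pow2_lt; rewrite /p2; move: s0; lra. Qed.

(* Even indices cover the dyadic annuli inside the unit cube, odd ones those outside. *)
Definition ann_radius (k : nat) : R := if odd k then 2 ^+ k.+1 else 2 ^- k.
(** The majorant at the inner radius of the annulus: q^-p1 at q = 2^-(k+2) for even [k], q^-p2 at q
    = 2^(k-1) for odd [k]. *)
Definition ann_weight (k : nat) : R :=
  if odd k then b2 / b2 ^+ k else b1 ^+ k.+2.

Lemma ann_radius_ge0 k : 0 <= ann_radius k.
Proof. by rewrite /ann_radius; case: ifP => _; rewrite ?invr_ge0 exprn_ge0. Qed.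

Lemma ann_weight_ge0 k : 0 <= ann_weight k.
Proof.
rewrite /ann_weight; case: ifP => _; last by rewrite exprn_ge0 ?ltW.
by rewrite divr_ge0 ?exprn_ge0// ltW.
Qed.

(** Up to constants the terms are (b1 / 2^n)^k for even [k] and (2^n / b2)^k for odd [k]; both
    ratios are below 1 because p1 < n < p2. *)
Lemma ann_series_bounded : exists C : R, 0 <= C /\
  (\sum_(0 <= k <oo) (ann_weight k * (2 * ann_radius k) ^+ n)%:E <= C%:E)%E.
Proof.
pose q := Num.max (2 ^+ n / b2) (b1 / 2 ^+ n).
pose K := b2 * 4 ^+ n + b1 ^+ 2 * 2 ^+ n.
have K0 : 0 <= K by rewrite addr_ge0 ?mulr_ge0 ?exprn_ge0 ?ltW.
have q0 : 0 < q by rewrite lt_max divr_gt0.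
have q1 : q < 1 by rewrite gt_max !ltr_pdivrMr ?exprn_gt0// !mul1r b1_lt b2_gt.
exists (K / (1 - q)); split; first by rewrite divr_ge0// subr_ge0 ltW.
apply: nneseries_le_geometric => //; first by rewrite q0.
move=> k; rewrite mulr_ge0 ?ann_weight_ge0 ?exprn_ge0 ?mulr_ge0 ?ann_radius_ge0//=.
rewrite /ann_weight /ann_radius; case: ifP => _.
- have -> : b2 / b2 ^+ k * (2 * 2 ^+ k.+1) ^+ n = b2 * 4 ^+ n * (2 ^+ n / b2) ^+ k.
    rewrite !expr_div_n -!exprS -!exprM.
    rewrite (_ : k.+2 * n = 2 * n + n * k)%N; last by rewrite -addn2 mulnDl addnC (mulnC k).
    rewrite exprD exprM -natrX; ring.
  apply: ler_pM.
  + by rewrite mulr_ge0 ?exprn_ge0// ltW.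
  + by rewrite exprn_ge0// divr_ge0 ?exprn_ge0// ltW.
  + by rewrite lerDl mulr_ge0 ?exprn_ge0// ltW.
  + by rewrite lerXn2r ?nnegrE ?(ltW q0)// ?divr_ge0 ?exprn_ge0 ?(ltW b2_gt0)// le_max lexx.
- have -> : b1 ^+ k.+2 * (2 / 2 ^+ k) ^+ n = b1 ^+ 2 * 2 ^+ n * (b1 / 2 ^+ n) ^+ k.
    rewrite !expr_div_n -!exprM (mulnC k n) !exprS; ring.
  apply: ler_pM.
  + by rewrite mulr_ge0 ?exprn_ge0// ltW.
  + by rewrite exprn_ge0// divr_ge0 ?exprn_ge0// ltW.
  + by rewrite lerDr mulr_ge0 ?exprn_ge0// ltW.
  + by rewrite lerXn2r ?nnegrE ?(ltW q0)// ?divr_ge0 ?exprn_ge0 ?(ltW b1_gt0)// le_max lexx orbT.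
Qed.

(** Boxes are measured in the sup norm [rho], the kernel in the Euclidean norm [q]. Both majorants
    decrease, so [q] may be replaced by the smaller [rho]. *)
Lemma kernel_le_weight (rho q : R) : 0 < rho -> rho <= q ->
  exists k, rho <= ann_radius k /\ Num.min 1 (q ^+ 2) / q `^ p2 <= ann_weight k.
Proof.
move=> rho0 rhoq; have q0 := lt_le_trans rho0 rhoq.
have [rho1|rho1] := leP rho 1.
- have : 1 <= rho^-1 by rewrite invf_ge1.
  move=> /exists_pow4[j /andP[jl jr]]; exists j.*2.
  rewrite /ann_radius /ann_weight odd_double; split.
    rewrite -mul2n exprM -natrX -[leLHS]invrK lef_pV2// posrE ?invr_gt0 ?exprn_gt0//.
  have rj : 2 ^- (j.*2.+2) <= rho.
    rewrite -doubleS -mul2n exprM -natrX -[leRHS]invrK lef_pV2// posrE ?invr_gt0 ?exprn_gt0//.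
  (* Both cases occur: [rho] is at most 1 here, but [q] may exceed 1. *)
  have min_le : Num.min 1 (q ^+ 2) <= q `^ (1 + s).
    rewrite ge_min; have [q1|q1] := leP 1 q.
      apply/orP; left; apply: (@le_trans _ _ (1 `^ (1 + s))); first by rewrite powR1.
      by rewrite ge0_ler_powR ?nnegrE//; move: s0 q0; lra.
    by rewrite -powR_mulrn ?(ltW q0)// ger_powR ?orbT// ?q0 ?(ltW q1)//; move: s1; lra.
  apply: (@le_trans _ _ (q `^ (- p1))).
    rewrite ler_pdivrMr ?powR_gt0// -powRD; last by rewrite (gt_eqF q0) implybT.
    by rewrite (_ : - p1 + p2 = 1 + s)// /p1 /p2; ring.
  rewrite powRN /b1 -[X in _ <= X]invrK lef_pV2 ?posrE ?invr_gt0 ?exprn_gt0 ?powR_gt0//.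
  apply: (@le_trans _ _ (rho `^ p1)); last by rewrite ge0_ler_powR ?nnegrE ?(ltW rho0) ?(ltW q0) ?(ltW p10).
  have <- : (2 ^- j.*2.+2) `^ p1 = (2 `^ p1 ^+ j.*2.+2)^-1.
    by rewrite -powR_invn// powRAC powR_invn// powR_ge0.
  by rewrite ge0_ler_powR ?nnegrE ?invr_ge0 ?exprn_ge0 ?(ltW rho0) ?(ltW p10).
- have [j /andP[jl jr]] := exists_pow4 _ (ltW rho1); exists j.*2.+1.
  rewrite /ann_radius /ann_weight /= odd_double /=; split.
    by rewrite -doubleS -mul2n exprM -natrX.
  apply: (@le_trans _ _ (q `^ p2)^-1).
    by rewrite ler_pdivrMr ?powR_gt0// mulVf ?gt_eqF ?powR_gt0// ge_min lexx.
  apply: (@le_trans _ _ (rho `^ p2)^-1).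
    by rewrite lef_pV2 ?posrE ?powR_gt0// ge0_ler_powR ?nnegrE ?(ltW rho0) ?(ltW q0) ?(ltW p20).
  rewrite exprS invfM mulrA divff ?gt_eqF// mul1r lef_pV2 ?posrE ?exprn_gt0 ?powR_gt0//.
  rewrite /b2 -powR_mulrn ?powR_ge0// powRAC ge0_ler_powR ?nnegrE ?powR_ge0 ?(ltW rho0) ?(ltW p20)//.
  by rewrite powR_mulrn// -mul2n exprM -natrX.
Qed.

End majorant.
End kernel.

(** * Bounds for the integral over the whole space *)

Section integral_estimates.
Context {R : realType}.

Lemma indic_box_prod (n : nat) (p : nat -> R) r (b : nat -> R) : 0 <= r ->
  \prod_(i < n) \1_(box p r i) (b i) =
  (`|\row_(i < n) b i - \row_(i < n) p i| <= r)%R%:R :> R.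
Proof.
move=> r0; set y := _ - _.
have yE (i : 'I_n) : (b i \in box p r i) = (`|y ord0 i| <= r).
  rewrite /y !mxE /box; apply/idP/idP; rewrite inE/= in_itv/= ler_norml.
    by move=> /andP[? ?]; apply/andP; split; lra.
  by move=> /andP[? ?]; apply/andP; split; lra.
have [yr|ry] := leP `|y| r.
  rewrite big1// => i _; rewrite indicE yE.
  by rewrite (le_trans (coord_le_norm y i) yr).
have /mx_norm_neq0[[i j]] : mx_norm y != 0 by rewrite gt_eqF// (le_lt_trans r0 ry).
rewrite (ord1 i) /= => yj.
rewrite (bigD1 j)//= indicE yE leNgt.
by move: ry; rewrite {1}/Num.norm/= yj => ->; rewrite mul0r.
Qed.

(** The integrand lies below a weighted series of box indicators, whose iterated integral is
    explicit. [C] depends on [n] and [s] only, so the exponent of the barrier can be chosen after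
    it. *)
Lemma integral_Rn_le_kernel (n : nat) (s : R) : (0 < n)%N -> 0 < s < 1 ->
  exists C : R, 0 <= C /\ forall (f : 'rV[R]_n -> R) A, 0 <= A ->
  (forall y, f y <= A * (Num.min 1 (enorm y ^+ 2) / enorm y `^ (n%:R + 2 * s))) ->
  (integral_Rn f <= (A * C)%:E)%E.
Proof.
move=> n0 s01; have [C [C0 hC]] := @ann_series_bounded R n s s01.
exists C; split=> // f A A0 fA.
pose c k := A * ann_weight n s k.
have c0 k : 0 <= c k by rewrite mulr_ge0// ann_weight_ge0.
pose r k : R := ann_radius k.
have r0 k : 0 <= r k := ann_radius_ge0 k.
pose p : nat -> R := fun=> 0.
rewrite /integral_Rn.
apply: (@le_trans _ _ (iint n (fun b => (\sum_(0 <= k <oo)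
   (c k * \prod_(i < n) \1_(box p (r k) i) (b i))%:E)%E) (fun=> 0))).
  apply: le_iint => b _; set y := \row_i b i.
  pose F k := c k * \prod_(i < n) \1_(box p (r k) i) (b i).
  have F0 k : 0 <= F k by rewrite mulr_ge0// prodr_ge0.
  (* At the origin [kernel_le_weight] does not apply, but there the bound on [f] is 0 because min(1,
     0) = 0. *)
  have [y0|y0] := eqVneq y 0.
    apply: (@le_trans _ _ 0%E); last by apply: nneseries_ge0 => k _ _; rewrite lee_fin F0.
    rewrite lee_fin (le_trans (fA y))// y0 enorm0 expr0n/=.
    by rewrite (min_idPr _) ?ler01// mul0r mulr0.
  have ny0 : 0 < `|y| by rewrite normr_gt0.
  have [k [kr kw]] := @kernel_le_weight _ _ _ n0 s01 _ _ ny0 (norm_le_enorm y).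
  apply: (@le_trans _ _ (F k)%:E); last exact: (@nneseries_ge_term _ F k F0).
  rewrite lee_fin (le_trans (fA y))// /F indic_box_prod//.
  rewrite (_ : \row_i _ - _ = y); last by apply/rowP => i; rewrite !mxE subr0.
  by rewrite kr mulr1 ler_wpM2l.
rewrite iint_box_series//.
under eq_eseriesr => k _ do rewrite /c -mulrA EFinM.
rewrite nneseriesZl; last by move=> k _; rewrite lee_fin mulr_ge0 ?ann_weight_ge0 ?exprn_ge0 ?mulr_ge0.
by rewrite EFinM lee_wpmul2l.
Qed.

(** Comparison with [- c] times the indicator of a cube, which has positive volume. *)
Lemma integral_Rn_lt0 (n : nat) (f : 'rV[R]_n -> R) (y0 : 'rV[R]_n) (c r : R) :
  0 < c -> 0 < r -> (forall y, f y <= 0) ->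
  (forall y, `|y - y0| <= r -> f y <= - c) -> (integral_Rn f < 0)%E.
Proof.
move=> c0 r0 f0 fc.
(* [y0] extended by 0 to a sequence on all naturals; only the entries below [n] are read. *)
pose p k := if insub k is Some i then y0 ord0 i else 0.
have py : \row_(i < n) p i = y0.
  by apply/rowP => i; rewrite mxE /p valK.
rewrite /integral_Rn.
apply: (@le_lt_trans _ _ (iint n (fun b => (- c * \prod_(i < n) \1_(box p r i) (b i))%:E) (fun=> 0))).
  apply: le_iint => b _; rewrite lee_fin indic_box_prod ?(ltW r0)// py.
  by have [h|h] := leP `|\row_i b i - y0| r; rewrite ?mulr1 ?mulr0 ?f0 ?fc.
rewrite iint_box ?(ltW r0)// lte_fin mulNr oppr_lt0 mulr_gt0// exprn_gt0// mulr_gt0//.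
Qed.

End integral_estimates.

(** * Directional derivatives *)

Section directional_derivatives.
Context {R : realType} {V : normedModType R}.
Implicit Types (f : V -> R) (x v : V).

(** Without the quotient the estimate is trivial at [h = 0], so full neighbourhoods replace
    punctured ones and can be pulled back along continuous maps. *)
Lemma is_derive_epsP f x v (d : R) : is_derive x v f d <->
  forall e, 0 < e -> \forall h \near (0 : R), `|f (x + h *: v) - f x - h * d| <= e * `|h|.
Proof.
have E (h : R) : h != 0 -> h^-1 *: ((f \o shift x) (h *: v) - f x) - d =
    h^-1 * (f (x + h *: v) - f x - h * d).
  by move=> h0; rewrite /= (addrC x) [RHS]mulrBr mulKf.
split=> [[df dfd] e e0|H].
- have : (fun h => h^-1 *: ((f \o shift x) (h *: v) - f x)) @ 0^' --> d.
    by rewrite -dfd.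
  move=> /cvgrPdist_le/(_ e e0); rewrite near_withinE => H; near=> h.
  have [->|h0] := eqVneq h 0.
    by rewrite scale0r addr0 subrr mul0r subrr !normr0 mulr0.
  have : `|d - h^-1 *: ((f \o shift x) (h *: v) - f x)| <= e.
    by apply: (near H h) => //.
  by rewrite distrC E// normrM normfV ler_pdivrMl ?normr_gt0// (mulrC _ e).
- have c : (fun h => h^-1 *: ((f \o shift x) (h *: v) - f x)) @ 0^' --> d.
    apply/cvgrPdist_le => e e0; rewrite near_withinE; near=> h => h0.
    rewrite distrC E// normrM normfV ler_pdivrMl ?normr_gt0// (mulrC _ e).
    by near: h; exact: H.
  by split; [apply/cvg_ex; exists d|exact: cvg_lim].
Unshelve. all: by end_near. Qed.

End directional_derivatives.

Section along_lines.
Context {R : realType} {V : normedModType R}.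
Implicit Types (f : V -> R) (x v : V).

Lemma is_derive_line f x v t : derivable f (x + t *: v) v ->
  is_derive t 1 (fun r : R => f (x + r *: v)) ('D_v f (x + t *: v)).
Proof.
move=> df; apply/is_derive_epsP => e e0.
have /is_derive_epsP/(_ e e0) : is_derive (x + t *: v) v f ('D_v f (x + t *: v)) by exact: derivableP.
by apply: filterS => h; rewrite [h *: 1]mulr1 scalerDl addrA.
Qed.

Lemma continuous_line f x v : continuous f -> continuous (fun r : R => f (x + r *: v)).
Proof.
move=> cf t; apply: (@continuous_comp _ _ _ (fun r : R => x + r *: v) f); last exact: cf.
by apply: cvgD; [exact: cvg_cst|apply: cvgZ; [exact: cvg_id|exact: cvg_cst]].
Qed.

Lemma MVT_line f x v (a : R) : 0 < a -> continuous f ->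
  (forall t, 0 < t < a -> derivable f (x + t *: v) v) ->
  exists t, 0 < t < a /\ f (x + a *: v) - f x = a * 'D_v f (x + t *: v).
Proof.
move=> a0 cf df.
have [||t] := @MVT R (fun r => f (x + r *: v)) (fun r => 'D_v f (x + r *: v)) 0 a a0.
- by move=> t; rewrite in_itv/= => ta; apply: is_derive_line; exact: df.
- by apply: continuous_subspaceT; exact: continuous_line.
by rewrite in_itv/= scale0r addr0 subr0 => ta ft; exists t; rewrite ft mulrC.
Qed.

Lemma MVT_line_sym f x v (a : R) : continuous f ->
  (forall t, `|t| <= `|a| -> derivable f (x + t *: v) v) ->
  exists t, `|t| <= `|a| /\ f (x + a *: v) - f x = a * 'D_v f (x + t *: v).
Proof.
move=> cf df; have [a0|a0|->] := ltgtP a 0.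
(* For negative [a] the segment is traversed from its other end. *)
- have Na0 : 0 < - a by rewrite oppr_gt0.
  have [t /andP[t0 ta]|t [/andP[t0 ta] ft]] := @MVT_line f (x + a *: v) v (- a) Na0 cf.
    rewrite -addrA -scalerDl; apply: df.
    by rewrite !ler0_norm; lra.
  exists (a + t); split; first by rewrite !ler0_norm; lra.
  move: ft; rewrite -!addrA -!scalerDl addrN scale0r addr0 => ft.
  by apply: oppr_inj; rewrite opprB ft mulNr.
- have [t /andP[t0 ta]|t [/andP[t0 ta] ft]] := @MVT_line f x v a a0 cf.
    by apply: df; rewrite !gtr0_norm// ltW.
  by exists t; split=> //; rewrite !gtr0_norm// ltW.
- by exists 0; rewrite !scale0r addr0 subrr mul0r.
Qed.

(** The second derivative exists at [x] only, so the mean value theorem is applied once, to H(t) =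
    f(x+tv) + f(x-tv) - L t^2. If the second derivative M were below L, then H' < 0 for small t > 0,
    against the assumed lower bound at [a]. *)
Lemma second_derivative_ge f x v (L : R) : continuous f ->
  (\forall z \near x, derivable f z v) -> derivable ('D_v f) x v ->
  (\forall t \near 0^'+, L * t ^+ 2 <= f (x + t *: v) + f (x - t *: v) - 2 * f x) ->
  L <= 'D_v ('D_v f) x.
Proof.
move=> cf df ddf Lf; rewrite leNgt; apply/negP => ML.
set M := 'D_v _ x in ML; pose g := 'D_v f.
(* The errors at t and -t add up to (L - M) t, which leaves H'(t) <= (M - L) t. *)
have e0 : 0 < (L - M) / 2 by lra.
have gd : is_derive x v g M by exact: derivableP.
have /is_derive_epsP/(_ _ e0) gq := gd.
have lim0 : (x + t *: v) @[t --> (0 : R)] --> x.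
  suff : (x + t *: v) @[t --> (0 : R)] --> x + 0 *: v by rewrite scale0r addr0.
  by apply: cvgD; [exact: cvg_cst|apply: cvgZ; [exact: cvg_id|exact: cvg_cst]].
have dfl : \forall t \near (0:R), derivable f (x + t *: v) v := lim0 _ df.
have /nbhs_ballP[d /= d0 hd] : \forall t \near (0 : R), derivable f (x + t *: v) v /\
    `|g (x + t *: v) - g x - t * M| <= (L - M) / 2 * `|t| by apply: filterI.
have inb t : `|t| < d -> ball (0:R) d t by rewrite /ball/= sub0r normrN.
near (0:R)^'+ => a.
have a0 : 0 < a by near: a; exact: nbhs_right_gt.
have ad : a < d by near: a; exact: nbhs_right_lt.
have La : L * a ^+ 2 <= f (x + a *: v) + f (x - a *: v) - 2 * f x by near: a.
pose H t := f (x + t *: v) + f (x + t *: (- v)) - L * t ^+ 2.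
have dfN t : derivable f (x + t *: (- v)) v -> is_derive t 1 (fun r : R => f (x + r *: (- v))) (- 'D_v f (x + t *: (- v))).
  move=> dft; apply/is_derive_epsP => e ee.
  have /is_derive_epsP/(_ e ee) P : is_derive (x + t *: (-v)) v f ('D_v f (x + t *: (-v))) by exact: derivableP.
  have N0 : - h @[h --> (0 : R)] --> (0 : R).
    by rewrite -[X in _ --> X]oppr0; apply: cvgN; exact: cvg_id.
  have PN : \forall h \near (0 : R), `|f (x + t *: - v + - h *: v) - f (x + t *: - v) -
      - h * 'D_v f (x + t *: - v)| <= e * `|- h| by exact: (N0 _ P).
  apply: filterS PN => h.
  by rewrite [h *: 1]mulr1 scalerDl addrA !scalerN scaleNr normrN mulrN mulNr.
have [||t] := @MVT R H (fun t => g (x + t *: v) - g (x - t *: v) - 2 * L * t) 0 a a0.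
- move=> t; rewrite in_itv/= => /andP[t0 ta].
  have td : `|t| < d by rewrite gtr0_norm// (lt_trans ta).
  have [dft _] := hd t (inb _ td).
  have [dfNt _] : derivable f (x + (- t) *: v) v /\ True.
    by split=> //; case: (hd (- t)) => //; apply: inb; rewrite normrN.
  rewrite scaleNr -scalerN in dfNt.
  have d1 := is_derive_line _ _ _ _ dft; have d2 := dfN t dfNt.
  have rid (A B : R) : A - B - L * (t + t) = A - B - 2 * L * t by ring.
  by rewrite /H; apply: is_derive_eq; rewrite /g scalerN [t%:A]mulr1; exact: rid.
- apply: continuous_subspaceT => t; rewrite /H.
  apply: cvgB; first by apply: cvgD; exact: continuous_line.
  by apply: cvgM; [exact: cvg_cst|exact: exprn_continuous].
rewrite in_itv/= /H => /andP[t0 ta].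
have td : `|t| < d by rewrite gtr0_norm// (lt_trans ta).
have [_ g1] := hd t (inb _ td).
have [_ g2] : derivable f (x + (- t) *: v) v /\ `|g (x + (- t) *: v) - g x - (- t) * M| <= (L - M) / 2 * `|- t|.
  by apply: hd; apply: inb; rewrite normrN.
move: g1 g2; rewrite !ler_norml normrN (gtr0_norm t0) scaleNr => /andP[_ g1] /andP[g2 _].
rewrite !scale0r !addr0 expr0n/= mulr0 !subr0 scalerN.
have ta0 : 0 < t * a by rewrite mulr_gt0.
set G := g (x + t *: v) in g1 *; set G' := g (x - t *: v) in g2 *.
have GG : G - G' - 2 * L * t <= (M - L) * t by lra.
have : (G - G' - 2 * L * t) * a < 0.
  by rewrite pmulr_llt0// (le_lt_trans GG)// pmulr_llt0// subr_lt0.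
by move: La; lra.
Unshelve. all: by end_near. Qed.

End along_lines.

(** * Total differentiability from partial derivatives *)

Section gradients.
Context {R : realType} {n : nat}.
Local Notation V := 'rV[R]_n.
Implicit Types (f : V -> R) (x y z h v : V).

Lemma norm_le_coord x (r : R) : 0 <= r -> (forall i, `|x ord0 i| <= r) -> `|x| <= r.
Proof.
move=> r0 xr; rewrite {1}/Num.norm/= mx_normrE; apply: bigmax_le => // -[i j] _ /=.
by rewrite (ord1 i).
Qed.

(** Telescoping over the coordinates: [hk k] keeps the first [k] entries of [h], and each step moves
    along one basis vector, where the mean value theorem applies. Truncation does not increase the
    sup norm, so all points stay in the [delta]-ball. *)
Lemma partial_estimate f y (d : 'I_n -> R) (delta eta : R) : 0 <= eta -> continuous f ->
  (forall z i, `|z - y| <= delta -> derivable f z (ebasis R i) /\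
     `|'D_(ebasis R i) f z - d i| <= eta) ->
  forall h, `|h| <= delta ->
  `|f (y + h) - f y - \sum_i h ord0 i * d i| <= eta * (n%:R * `|h|).
Proof.
move=> eta0 cf fd h hdelta.
pose hk k : V := \row_i (if (i < k)%N then h ord0 i else 0).
suff H k : (k <= n)%N -> `|f (y + hk k) - f y - \sum_(i < n | (i < k)%N) h ord0 i * d i| <= eta * (k%:R * `|h|).
  have := H n (leqnn n).
  have -> : hk n = h by apply/rowP => i; rewrite mxE ltn_ord.
  by under eq_bigl do rewrite ltn_ord.
elim: k => [_|k IH kn].
  have -> : hk 0 = 0 by apply/rowP => i; rewrite !mxE.
  by rewrite big_pred0 ?addr0 ?subrr ?subr0 ?normr0 ?mul0r ?mulr0.
pose ko := Ordinal kn.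
have hkS : hk k.+1 = hk k + h ord0 ko *: ebasis R ko.
  apply/rowP => i; rewrite !mxE eqxx/= ltnS leq_eqVlt -(inj_eq val_inj)/=.
  have [ik|ik] := eqVneq (val i) k; last by rewrite mulr0 addr0.
  by rewrite ik ltnn add0r mulr1; congr (h _ _); apply: val_inj.
have near t : `|t| <= `|h ord0 ko| -> `|y + hk k + t *: ebasis R ko - y| <= delta.
  move=> th; rewrite (addrC y) addrAC addrK; apply: le_trans hdelta.
  apply: norm_le_coord => // i; rewrite !mxE eqxx/= -(inj_eq val_inj)/=.
  have [->|ik] := eqVneq (val i) k.
    by rewrite ltnn add0r mulr1 (le_trans th)// coord_le_norm.
  by rewrite mulr0 addr0; case: ifP => _; rewrite ?normr0// coord_le_norm.
have fdk t th := fd (y + hk k + t *: ebasis R ko) ko (near t th).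
have [t /fdk[]//|t [/fdk[_ Dd] ft]] := @MVT_line_sym _ _ f (y + hk k) (ebasis R ko) (h ord0 ko) cf.
have -> : \sum_(i < n | (i < k.+1)%N) h ord0 i * d i = h ord0 ko * d ko + \sum_(i < n | (i < k)%N) h ord0 i * d i.
  rewrite (bigD1 ko)//=; congr (_ + _); apply: eq_bigl => i.
  by rewrite -(inj_eq val_inj)/= ltnS ltn_neqAle andbC.
rewrite hkS addrA.
set S := \sum_(i < n | _) _.
rewrite (_ : _ - _ = (f (y + hk k) - f y - S) + h ord0 ko * ('D_(ebasis R ko) f (y + hk k + t *: ebasis R ko) - d ko)); last first.
  by rewrite mulrBr -ft; ring.
rewrite (le_trans (ler_normD _ _))// -natr1 mulrDl mul1r [eta * _]mulrDr lerD//.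
  by apply: IH; exact: ltnW.
by rewrite normrM mulrC ler_pM// coord_le_norm.
Qed.

Lemma diff_estimate f y : continuous f ->
  (forall i, \forall z \near y, derivable f z (ebasis R i)) ->
  (forall i, {for y, continuous ('D_(ebasis R i) f)}) ->
  forall e, 0 < e -> \forall h \near (0 : V),
  `|f (y + h) - f y - \sum_i h ord0 i * 'D_(ebasis R i) f y| <= e * `|h|.
Proof.
move=> cf df cdf e e0.
(* Dividing by n + 1 instead of n also covers n = 0. *)
pose eta := e / n.+1%:R.
have eta0 : 0 < eta by rewrite divr_gt0.
have : nbhs y [set z | forall i, derivable f z (ebasis R i) /\
     `|'D_(ebasis R i) f z - 'D_(ebasis R i) f y| <= eta].
  apply: (filter_forall (nbhs_filter y)) => i; apply: filterI; first exact: df.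
  have /cvgrPdist_le/(_ _ eta0) := cdf i.
  by apply: filterS => z; rewrite distrC.
move=> /nbhs_normP[delta /= delta0 H].
have dd : 0 < delta / 2 by rewrite divr_gt0.
apply/nbhs_normP; exists (delta / 2) => // h; rewrite /= sub0r normrN => /ltW hd.
have := @partial_estimate f y (fun i => 'D_(ebasis R i) f y) (delta / 2) eta (ltW eta0) cf _ h hd.
move=> /(_ _)/le_trans; apply.
  by move=> z i zy; apply: H; rewrite /= distrC (le_lt_trans zy)// ltr_pdivrMr// ltr_pMr// ltr1n.
rewrite mulrA ler_wpM2r// /eta mulrAC ler_pdivrMr// ler_wpM2l ?(ltW e0)// ler_nat//.
Qed.

Lemma is_derive_grad f y v : continuous f ->
  (forall i, \forall z \near y, derivable f z (ebasis R i)) ->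
  (forall i, {for y, continuous ('D_(ebasis R i) f)}) ->
  is_derive y v f (\sum_i v ord0 i * 'D_(ebasis R i) f y).
Proof.
move=> cf df cdf; apply/is_derive_epsP => e e0.
pose c := e / (`|v| + 1).
have v1 : 0 < `|v| + 1 by rewrite ltr_wpDl.
have c0 : 0 < c by rewrite divr_gt0.
have H := diff_estimate f y cf df cdf c c0.
have lim0 : h *: v @[h --> (0 : R)] --> (0 : V).
  rewrite -[X in _ --> X](scale0r v).
  by apply: cvgZ; [exact: cvg_id|exact: cvg_cst].
have P : \forall h \near (0 : R), `|f (y + h *: v) - f y -
    \sum_i (h *: v) ord0 i * 'D_(ebasis R i) f y| <= c * `|h *: v| := lim0 _ H.
apply: filterS P => h /=.
rewrite mulr_sumr; under eq_bigr do rewrite mxE -mulrA.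
move=> /le_trans; apply; rewrite normrZ /c.
rewrite (_ : _ * _ = e * `|h| * (`|v| / (`|v| + 1))); last by ring.
by rewrite ler_piMr ?mulr_ge0 ?(ltW e0)// ler_pdivrMr// mul1r lerDl.
Qed.

End gradients.

(** * Geometry of the boundary *)

Lemma near_all (T : topologicalType) (x : T) (P : T -> Prop) :
  (forall z, P z) -> \forall z \near x, P z.
Proof. by move=> H; apply: (filterS _ (nbhs_filter x).(filterT)). Qed.

Section boundary_geometry.
Context {R : realType} {n : nat}.
Local Notation V := 'rV[R]_n.
Implicit Types (Omega : set V) (f g : V -> R) (x y z h v e : V).

Lemma Ck_continuous k f : Ck k f -> continuous f.
Proof. by case: k => //= k []. Qed.

Lemma Ck_derivable k f i x : Ck k.+1 f -> derivable f x (ebasis R i).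
Proof. by move=> [_ /(_ i)[]]. Qed.

Lemma Ck_partial k f i : Ck k.+1 f -> Ck k ('D_(ebasis R i) f).
Proof. by move=> [_ /(_ i)[]]. Qed.

Lemma Ck_near_derivable k f i x : Ck k.+1 f -> \forall z \near x, derivable f z (ebasis R i).
Proof. by move=> Cf; apply: near_all => z; exact: Ck_derivable Cf. Qed.

Lemma Ck_is_derive_grad k f x v : Ck k.+1 f -> is_derive x v f (dotp (grad f x) v).
Proof.
move=> Cf.
rewrite (_ : dotp _ _ = \sum_i v ord0 i * 'D_(ebasis R i) f x); last first.
  by apply: eq_bigr => i _; rewrite /grad mxE mulrC.
apply: is_derive_grad; first exact: Ck_continuous Cf.
  by move=> i; exact: Ck_near_derivable Cf.
by move=> i; apply: Ck_continuous (Ck_partial _ _ _ Cf) x.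
Qed.

(** Each partial derivative varies by at most [L * |h|] near [x]; [partial_estimate] on the ball of
    radius [|h|] then gives a quadratic remainder. *)
Lemma Ck2_taylor g x : Ck 2 g -> exists K delta, 0 < K /\ 0 < delta /\
  forall h, enorm h < delta -> `|g (x + h) - g x - dotp (grad g x) h| <= K * enorm h ^+ 2.
Proof.
move=> Cg.
pose D2 i j := 'D_(ebasis R j) ('D_(ebasis R i) g) x.
(* The double sum bounds the linear part of the variation of any partial derivative; the 1 is the
   error in [diff_estimate] with e = 1. *)
pose L := 1 + \sum_i \sum_j `|D2 i j|.
have L0 : 0 < L by rewrite ltr_pwDl// sumr_ge0// => i _; rewrite sumr_ge0.
have : nbhs (0 : V) [set h | forall i, `|'D_(ebasis R i) g (x + h) - 'D_(ebasis R i) g x| <= L * `|h|].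
  apply: (filter_forall (nbhs_filter (0 : V))) => i.
  have Ci := Ck_partial _ _ i Cg.
  have c0 := @diff_estimate R n ('D_(ebasis R i) g) x (Ck_continuous _ _ Ci).
  have {}c0 := c0 (fun j => Ck_near_derivable _ _ j x Ci) (fun j => Ck_continuous _ _ (Ck_partial _ _ j Ci) x) 1 ltr01.
  apply: filterS c0 => h /= H.
  rewrite -[X in `|X|](subrK (\sum_j h ord0 j * D2 i j)) (le_trans (ler_normD _ _))//.
  rewrite /L mulrDl lerD//.
  apply: le_trans (ler_norm_sum _ _ _) _; rewrite [X in _ <= X * _](bigD1 i)//= mulrDl.
  apply: ler_wpDr; first by rewrite mulr_ge0// sumr_ge0// => k _; rewrite sumr_ge0.
  rewrite mulr_suml; apply: ler_sum => j _.
  by rewrite normrM mulrC ler_wpM2l// coord_le_norm.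
move=> /nbhs_normP[delta /= delta0 H].
exists (L * n.+1%:R), delta; split; first by rewrite mulr_gt0.
split=> // h hd.
have hd' : `|h| < delta by apply: le_lt_trans hd; exact: norm_le_enorm.
have := @partial_estimate R n g x (fun i => 'D_(ebasis R i) g x) `|h| (L * `|h|).
move=> /(_ _ _ _ h (lexx _)); rewrite (_ : \sum_i _ = dotp (grad g x) h); last first.
  by apply: eq_bigr => i _; rewrite /grad mxE mulrC.
move=> H2; apply: le_trans (H2 _ _ _) _.
- by rewrite mulr_ge0// ltW.
- exact: Ck_continuous Cg.
- move=> z i zx; split; first exact: Ck_derivable Cg.
  have := H (z - x); rewrite /= sub0r normrN (le_lt_trans zx hd') => /(_ isT i).
  by rewrite (addrC x) subrK => /le_trans; apply; rewrite ler_wpM2l// ltW.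
- rewrite -!mulrA ler_wpM2l ?(ltW L0)// mulrCA ler_pM ?mulr_ge0//.
    by rewrite ler_nat.
  by rewrite -expr2 lerXn2r ?nnegrE ?enorm_ge0// norm_le_enorm.
Qed.

(** [g] is constant along [e], so only [- e] contributes. In particular the gradient of the local
    defining function does not vanish. *)
Lemma Ck_graph_unit Omega p r e g k : Ck_graph_at k.+1 Omega p r e g ->
  dotp (grad g p - e) e = -1.
Proof.
move=> [_ [e1 [Cg [ge _]]]].
have ee : dotp e e = 1 by rewrite -enorm_sqr e1 expr1n.
rewrite dotpDl dotpNl ee.
have [_ <-] := Ck_is_derive_grad k g p e Cg.
suff [_ ->] : is_derive p e g 0 by rewrite sub0r.
apply/is_derive_epsP => eps eps0; apply: near_all => t.
by rewrite ge subrr mulr0 subr0 normr0 mulr_ge0// ltW.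
Qed.

(** If [g p] were smaller, [p] would lie in the open set [Omega]; if larger, a neighbourhood of [p]
    would miss [Omega]. *)
Lemma Ck_graph_value Omega p r e g k : open Omega -> bdry Omega p ->
  Ck_graph_at k Omega p r e g -> g p = dotp p e.
Proof.
move=> oO [clp nip] [r0 [_ [Cg [_ gO]]]].
have cg := Ck_continuous _ _ Cg.
apply/eqP; rewrite eq_le; apply/andP; split; last first.
  rewrite leNgt; apply/negP => gp; apply: nip.
  have : Omega p by apply/gO => //; rewrite /eball/= subrr enorm0.
  exact: oO.
rewrite leNgt; apply/negP => gp.
have ce : continuous (fun x => dotp x e).
  by apply: (@dotp_continuous _ _ id (fun=> e)); [exact: (fun _ => cvg_id)|exact: cst_continuous].
have N : nbhs p [set x | dotp x e < g x].
  have cd : {for p, continuous (fun x => g x - dotp x e)}.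
    by apply: continuousB; [exact: cg|exact: ce].
  have d0 : 0 < g p - dotp p e by rewrite subr_gt0.
  have := cd; move=> /cvgr_gt/(_ _ d0); apply: filterS => x /=.
  by rewrite subr_gt0.
have [x [Ox [Nx Bx]]] := clp _ (filterI N (nbhs_eball p r r0)).
by move: Nx; rewrite /= ltNge (ltW ((gO x Bx).1 Ox)).
Qed.

End boundary_geometry.

(** * Interior ball and direction of the normal *)

Section interior_sphere.
Context {R : realType} {n : nat}.
Local Notation V := 'rV[R]_n.
Implicit Types (Omega : set V) (g : V -> R) (x y z h v e p : V).

(** With [N] the inner unit normal and y = p + h in the ball, |h|^2 < 2 rho <h,N>. The linear term -
    A <h,N> of g - <.,e> then beats the Taylor remainder K |h|^2. *)
Lemma interior_ball Omega p r e g : Ck_graph_at 2 Omega p r e g ->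
  g p = dotp p e ->
  exists x0 rho, 0 < rho /\ enorm (p - x0) = rho /\ eball x0 rho `<=` Omega.
Proof.
move=> G2 gp; have [r0 [e1 [Cg [_ gO]]]] := G2.
have Ge := Ck_graph_unit _ _ _ _ _ _ G2.
have [G GE] : exists G, G = grad g p - e by eexists.
rewrite -GE in Ge.
have G0 : G != 0.
  by apply/eqP => G0; move: Ge; rewrite G0 -(scale0r 0) dotpZl mul0r; lra.
have A0 : 0 < enorm G := enorm_gt0 _ G0.
have [A AE] : exists A, A = enorm G by eexists.
rewrite -AE in A0.
have [K [delta [K0 [delta0 taylor]]]] := Ck2_taylor g p Cg.
(* The ball has diameter 2 rho, which must fit the Taylor and the graph radius; the last entry gives
   2 K rho <= A. *)
pose rho := Num.min (Num.min (delta / 2) (r / 2)) (A / (2 * K)).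
have rho0 : 0 < rho by rewrite !lt_min !divr_gt0// mulr_gt0.
have rho_delta : 2 * rho <= delta.
  by rewrite mulrC -ler_pdivlMr// !ge_min lexx.
have rho_r : 2 * rho <= r.
  by rewrite mulrC -ler_pdivlMr// !ge_min lexx orbT.
have rho_A : rho * (2 * K) <= A.
  by rewrite -ler_pdivlMr ?mulr_gt0// !ge_min lexx orbT.
have [N NE] : exists N, N = - A^-1 *: G by eexists.
have NN : dotp N N = 1.
  by rewrite NE !dotp_simp -enorm_sqr -AE; field; rewrite gt_eqF.
have N1 : enorm N = 1 by rewrite /enorm NN sqrtr1.
exists (p + rho *: N), rho; split=> //; split.
  by rewrite opprD addNKr enormN enormZ N1 mulr1 gtr0_norm.
move=> y; rewrite /eball/= => yB.
have [h hE] : exists h, h = y - p by eexists.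
have yh : y = p + h by rewrite hE addrC subrK.
have hN : dotp h h < 2 * rho * dotp h N.
  have : enorm (h - rho *: N) ^+ 2 < rho ^+ 2.
    rewrite ltrXn2r// ?nnegrE ?enorm_ge0 ?(ltW rho0)//.
    by move: yB; rewrite opprD addrA hE.
  rewrite enorm_sqr !dotp_simp NN (dotpC N h); lra.
have hN0 : 0 < dotp h N.
  have : 0 < rho * dotp h N by have := dotp_ge0 h; lra.
  by rewrite pmulr_rgt0.
have h0 : 0 < enorm h.
  rewrite lt_neqAle enorm_ge0 andbT eq_sym; apply/eqP => h0.
  by have := dotp_le_enorm h N; rewrite h0 mul0r leNgt hN0.
have h2 : enorm h < 2 * rho.
  rewrite -(ltr_pM2l h0) -expr2 enorm_sqr (lt_le_trans hN)// mulrC ler_wpM2r//.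
    by rewrite mulr_ge0// ltW.
  by have := dotp_le_enorm h N; rewrite N1 mulr1.
apply/gO; first by rewrite /eball/= -hE (lt_le_trans h2).
have := taylor h (lt_le_trans h2 rho_delta).
rewrite -yh gp yh dotpDl ler_norml => /andP[_].
have hG : dotp (grad g p) h = dotp h e - A * dotp h N.
  have -> : A * dotp h N = - dotp h G.
    by rewrite NE !(dotpNr, dotpZr); field; rewrite gt_eqF.
  by rewrite GE dotpDr dotpNr (dotpC h (grad g p)); ring.
rewrite hG -yh enorm_sqr.
have KhN : K * dotp h h < A * dotp h N.
  apply: (@lt_le_trans _ _ (K * (2 * rho * dotp h N))); first by rewrite ltr_pM2l.
  rewrite mulrA ler_wpM2r ?(ltW hN0)//; move: rho_A; rewrite (_ : K * (2 * rho) = rho * (2 * K))//; ring.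
lra.
Qed.

(** Let q be the part of G orthogonal to b. Testing with q - t b and letting t tend to 0 forces q =
    0; testing with - b gives the sign of the factor. *)
Lemma parallel_of_halfspace (G b : V) : b != 0 -> G != 0 ->
  (forall d, dotp d b < 0 -> dotp G d <= 0) -> exists2 c, 0 < c & G = c *: b.
Proof.
move=> b0 G0 H.
have bb : 0 < dotp b b by rewrite -enorm_sqr exprn_gt0 ?enorm_gt0.
pose c := dotp G b / dotp b b.
have [q qE] : exists q, q = G - c *: b by eexists.
have qb : dotp q b = 0 by rewrite qE !dotp_simp /c; field; rewrite gt_eqF.
have Gq : G = q + c *: b by rewrite qE subrK.
have qq : dotp q q <= 0.
  apply/ler_addgt0Pr => eps eps0; rewrite add0r.
  pose t := eps / (`|dotp G b| + 1).
  have D0 : 0 < `|dotp G b| + 1 by rewrite ltr_wpDl.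
  have t0 : 0 < t by rewrite divr_gt0.
  have := H (q - t *: b).
  rewrite !dotp_simp qb sub0r oppr_lt0 mulr_gt0// => /(_ isT).
  have -> : dotp G q = dotp q q by rewrite {1}Gq !dotp_simp (dotpC b) qb; ring.
  have : t * dotp G b <= eps.
    apply: (@le_trans _ _ (t * (`|dotp G b| + 1))).
      by rewrite ler_pM2l// (le_trans (ler_norm _))// lerDl.
    by rewrite /t divfK ?gt_eqF.
  lra.
have q0 : q = 0 by apply: dotp_eq0; apply/eqP; rewrite eq_le qq dotp_ge0.
have GE : G = c *: b by rewrite Gq q0 add0r.
exists c => //; rewrite lt_neqAle; apply/andP; split.
  by apply: contra G0 => /eqP c0; rewrite GE -c0 scale0r.
have := H (- b); rewrite !dotp_simp oppr_lt0 bb => /(_ isT).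
by rewrite oppr_le0 /c => Gb; rewrite divr_ge0// ltW.
Qed.

(** The graph defining the normal may differ from the one that produced the ball. A direction [d]
    with <d, p - x0> < 0 enters the ball, hence [Omega], so g - <.,e> does not increase along it at
    first order; [parallel_of_halfspace] concludes. *)
Lemma outer_normal_radial Omega p r e g x0 rho : Ck_graph_at 1 Omega p r e g ->
  g p = dotp p e -> 0 < rho -> enorm (p - x0) = rho -> eball x0 rho `<=` Omega ->
  exists2 c, 0 < c & (enorm (grad g p - e))^-1 *: (grad g p - e) = c *: (p - x0).
Proof.
move=> G1 gp rho0 prho BO; have [r0 [e1 [Cg [_ gO]]]] := G1.
have Ge := Ck_graph_unit _ _ _ _ _ _ G1.
have [G GE] : exists G, G = grad g p - e by eexists.
rewrite -GE in Ge *.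
have G0 : G != 0.
  by apply/eqP => G0; move: Ge; rewrite G0 -(scale0r 0) dotpZl mul0r; lra.
have [b bE] : exists b, b = p - x0 by eexists.
rewrite -bE in prho *.
have b0 : b != 0 by apply/eqP => b0; move: prho; rewrite b0 enorm0; lra.
have [d db|c c0 Gc] := parallel_of_halfspace G b b0 G0; last first.
  exists ((enorm G)^-1 * c); first by rewrite mulr_gt0 ?invr_gt0 ?enorm_gt0.
  by rewrite {2}Gc scalerA.
rewrite GE dotpDl dotpNl subr_le0; apply/ler_addgt0Pr => eps eps0.
have /is_derive_epsP/(_ _ eps0) Dg := Ck_is_derive_grad _ g p d Cg.
have near_r : \forall t \near (0:R), t * enorm d < r.
  have c : t * enorm d @[t --> (0:R)] --> 0 * enorm d.
    by apply: cvgM; [exact: cvg_id|exact: cvg_cst].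
  by move: c => /cvgr_lt/(_ r); apply; rewrite mul0r.
(* Equivalent, for t > 0, to |b + t d| < |b| = rho. *)
have near_b : \forall t \near (0:R), t * dotp d d < - 2 * dotp d b.
  have c : t * dotp d d @[t --> (0:R)] --> 0 * dotp d d.
    by apply: cvgM; [exact: cvg_id|exact: cvg_cst].
  by move: c => /cvgr_lt/(_ (- 2 * dotp d b)); apply; rewrite mul0r; lra.
have /nbhs_normP[m /= m0 H] : \forall t \near (0:R),
    `|g (p + t *: d) - g p - t * dotp (grad g p) d| <= eps * `|t| /\
    t * enorm d < r /\ t * dotp d d < - 2 * dotp d b.
  by apply: (filterI Dg); exact: (filterI near_r near_b).
have [|Dt [tr tb]] := H (m / 2).
  by rewrite /= sub0r normrN gtr0_norm; lra.
set t := m / 2 in Dt tr tb.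
have t0 : 0 < t by rewrite divr_gt0.
have Bt : eball x0 rho (p + t *: d).
  rewrite /eball/= addrAC -bE -(@ltr_pXn2r _ 2)// ?nnegrE ?enorm_ge0 ?(ltW rho0)//.
  rewrite enorm_sqr !dotp_simp -enorm_sqr prho (dotpC b).
  have : t * (t * dotp d d) < t * (- 2 * dotp d b) by rewrite ltr_pM2l.
  lra.
have Br : eball p r (p + t *: d).
  by rewrite /eball/= addrAC subrr add0r enormZ gtr0_norm.
have := (gO _ Br).1 (BO _ Bt).
rewrite !dotp_simp -gp => gt.
move: Dt; rewrite ler_norml (gtr0_norm t0) => /andP[Dt _].
have : t * dotp (grad g p) d <= t * (dotp e d + eps) by rewrite (dotpC e); lra.
by rewrite ler_pM2l.
Qed.

End interior_sphere.

(** * The Gaussian barrier *)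

Section gaussian.
Context {R : realType}.

(** With w = z/2 the right side is 2 + (e^w - e^-w)^2, and e^w - e^-w >= (1 + w) - 1 for w >= 0. *)
Lemma expR_sum_ge (z : R) : 2 + z ^+ 2 / 4 <= expR z + expR (- z).
Proof.
wlog z0 : z / 0 <= z.
  move=> H; have [|/ltW z0] := leP 0 z; first exact: H.
  by have := H (- z); rewrite opprK sqrrN oppr_ge0 (addrC (expR _)) => /(_ z0).
pose w := z / 2.
have w0 : 0 <= w by rewrite divr_ge0.
have H1 : 1 + w <= expR w := expR_ge1Dx w.
have H2 : expR (- w) <= 1 by rewrite -expR0 ler_expR oppr_le0.
have -> : expR z + expR (- z) = 2 + (expR w - expR (- w)) ^+ 2.
  have -> : z = w + w by rewrite /w; field.
  rewrite opprD !expRD.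
  have : expR w * expR (- w) = 1 by rewrite -expRD subrr expR0.
  by rewrite sqrrB expr2 expr2 => ->; ring.
have -> : z ^+ 2 / 4 = w ^+ 2 by rewrite /w; field.
by rewrite lerD2l lerXn2r// ?nnegrE; lra.
Qed.

Context {n : nat}.
Local Notation V := 'rV[R]_n.

Definition gauss (alpha : R) (x : V) : R := expR (- alpha * dotp x x).

Lemma gauss_gt0 alpha x : 0 < gauss alpha x.
Proof. exact: expR_gt0. Qed.

Lemma gauss_continuous alpha : continuous (gauss alpha).
Proof.
move=> x; apply: (@continuous_comp _ _ _ (fun y => - alpha * dotp y y) expR); last exact: continuous_expR.
apply: continuousM; first exact: cst_continuous.
by apply: (@dotp_continuous R n id id) => y; exact: cvg_id.
Qed.

Lemma gauss_sum alpha x y : gauss alpha (x + y) + gauss alpha (x - y) =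
  gauss alpha x * gauss alpha y * (expR (2 * alpha * dotp x y) + expR (- (2 * alpha * dotp x y))).
Proof.
rewrite /gauss mulrDr -!expRD addrC; congr (expR _ + expR _);
  by rewrite !dotp_simp (dotpC y x); ring.
Qed.

(** By [gauss_sum] the left side is at most 2 f(x) (1 - f(y)), and 1 - exp(-alpha |y|^2) <= alpha
    min(1, |y|^2) when alpha >= 1. *)
Lemma gauss_second_diff_le alpha x y : 1 <= alpha ->
  2 * gauss alpha x - gauss alpha (x + y) - gauss alpha (x - y) <=
  2 * gauss alpha x * alpha * Num.min 1 (enorm y ^+ 2).
Proof.
move=> a1.
have f0 := gauss_gt0 alpha x; have g0 := gauss_gt0 alpha y.
have S := gauss_sum alpha x y.
have E := expR_sum_ge (2 * alpha * dotp x y).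
have E2 : 2 <= expR (2 * alpha * dotp x y) + expR (- (2 * alpha * dotp x y)).
  by apply: le_trans E; rewrite lerDl divr_ge0// sqr_ge0.
have S2 : gauss alpha x * gauss alpha y * 2 <= gauss alpha (x + y) + gauss alpha (x - y).
  by rewrite S ler_pM2l// mulr_gt0.
have g1 : 1 - alpha * dotp y y <= gauss alpha y.
  by rewrite -mulNr; exact: expR_ge1Dx.
rewrite -mulrA; apply: (@le_trans _ _ (2 * gauss alpha x * (1 - gauss alpha y))); first lra.
rewrite ler_wpM2l//; first by rewrite mulr_ge0// ltW.
rewrite enorm_sqr /Num.min; case: ifP => _; last by lra.
by rewrite mulr1; lra.
Qed.

(** A bound weaker than the exact second derivative f (4 alpha^2 x_i^2 - 2 alpha), but free of
    differentiation: the smallness of [t] keeps 1 - alpha t^2 above 1/2. *)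
Lemma gauss_second_diff_ge alpha x i (t : R) : 0 <= alpha -> alpha * t ^+ 2 <= 2^-1 ->
  gauss alpha x * (alpha ^+ 2 * x ord0 i ^+ 2 / 2 - 2 * alpha) * t ^+ 2 <=
  gauss alpha (x + t *: ebasis R i) + gauss alpha (x - t *: ebasis R i) - 2 * gauss alpha x.
Proof.
move=> a0 at2.
have f0 := gauss_gt0 alpha x; have g0 := gauss_gt0 alpha (t *: ebasis R i).
rewrite gauss_sum dotpZr dotp_ebasis.
set a := x ord0 i.
have E := expR_sum_ge (2 * alpha * (t * a)).
set S := expR _ + expR _ in E *.
have g1 : 1 - alpha * t ^+ 2 <= gauss alpha (t *: ebasis R i).
  apply: le_trans (expR_ge1Dx _).
  by rewrite !dotp_simp dotp_ebasis_self mulr1 -expr2 mulNr.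
set gt := gauss alpha (t *: _) in g0 g1 *.
have S0 : 0 <= S by apply: le_trans E; rewrite addr_ge0// divr_ge0// sqr_ge0.
have key : (alpha ^+ 2 * a ^+ 2 / 2 - 2 * alpha) * t ^+ 2 <= gt * S - 2.
  apply: (@le_trans _ _ ((1 - alpha * t ^+ 2) * (2 + (2 * alpha * (t * a)) ^+ 2 / 4) - 2)).
    have -> : (1 - alpha * t ^+ 2) * (2 + (2 * alpha * (t * a)) ^+ 2 / 4) - 2 =
       (alpha ^+ 2 * a ^+ 2 / 2 - 2 * alpha) * t ^+ 2 + (2^-1 - alpha * t ^+ 2) * (alpha * t * a) ^+ 2 by field.
    by rewrite lerDl mulr_ge0 ?sqr_ge0// subr_ge0.
  rewrite lerD2r; apply: (@le_trans _ _ ((1 - alpha * t ^+ 2) * S)).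
    by rewrite ler_wpM2l// subr_ge0; lra.
  by rewrite ler_wpM2r.
have := ler_wpM2l (ltW f0) key; lra.
Qed.

End gaussian.

(** * Derivatives of [u] at points of [Omega] *)

Section regularity_inside.
Context {R : realType} {n : nat}.
Local Notation V := 'rV[R]_n.
Variables (Omega : set V) (u : V -> R) (Du : 'I_n -> V -> R) (D2u : 'I_n -> 'I_n -> V -> R).
Hypotheses (oO : open Omega) (cu : continuous u) (C2 : C2_closure Omega u Du D2u).

Lemma C2_near_derivable i x : Omega x -> \forall z \near x, derivable u z (ebasis R i).
Proof. by move=> Ox; have := oO x Ox; apply: filterS => z /(C2.1 i)[]. Qed.

Lemma C2_near_partial i x : Omega x -> {near x, 'D_(ebasis R i) u =1 Du i}.
Proof. by move=> Ox; have := oO x Ox; apply: filterS => z /(C2.1 i)[]. Qed.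

Lemma C2_is_derive_grad x v : Omega x -> is_derive x v u (\sum_i v ord0 i * Du i x).
Proof.
move=> Ox.
rewrite (_ : \sum_i _ = \sum_i v ord0 i * 'D_(ebasis R i) u x); last first.
  by apply: eq_bigr => i _; rewrite (C2.1 i x Ox).2.
apply: is_derive_grad => // i; first exact: C2_near_derivable.
have cDu : {for x, continuous (Du i)}.
  have : {within Omega, continuous (Du i)}.
    by apply: continuous_subspaceW (C2.2.2.1 i); exact: subset_closure.
  by rewrite continuous_open_subspace// => /(_ x); apply; rewrite inE.
have P := C2_near_partial i x Ox.
rewrite /prop_for /continuous_at (C2.1 i x Ox).2.
apply: cvg_trans cDu; apply: (@near_eq_cvg _ _ _ (nbhs_filter x)).
by apply: (@filterS _ _ (nbhs_filter x) _ _ _ P) => z /= ->.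
Qed.

Lemma C2_second_partial_ge i x (L : R) : Omega x ->
  (\forall t \near 0^'+, L * t ^+ 2 <=
     u (x + t *: ebasis R i) + u (x - t *: ebasis R i) - 2 * u x) ->
  L <= 'D_(ebasis R i) ('D_(ebasis R i) u) x.
Proof.
move=> Ox HL; apply: second_derivative_ge => //; first exact: C2_near_derivable.
have P := C2_near_partial i x Ox.
apply: (@near_eq_derivable _ _ _ (Du i)); last by case: (C2.2.1 i i x Ox).
by apply: filterS P => z ->.
Qed.

Lemma C2_laplacian_ge x (L : 'I_n -> R) : Omega x ->
  (forall i, \forall t \near 0^'+, L i * t ^+ 2 <=
     u (x + t *: ebasis R i) + u (x - t *: ebasis R i) - 2 * u x) ->
  \sum_i L i <= laplacian u x.
Proof. by move=> Ox HL; apply: ler_sum => i _; exact: C2_second_partial_ge. Qed.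

End regularity_inside.

(** * Maximum principles *)

Section maximum_principles.
Context {R : realType} {n : nat}.
Local Notation V := 'rV[R]_n.
Implicit Types (x y z : V).
Variables (s c0 : R) (Omega : set V) (u : V -> R).
Variables (Du : 'I_n -> V -> R) (D2u : 'I_n -> 'I_n -> V -> R).
Hypotheses (s01 : 0 < s < 1) (oO : open Omega) (cu : continuous u).
Hypothesis C2 : C2_closure Omega u Du D2u.
Hypothesis Lu : forall x, Omega x -> (0 <= mixedL s u x)%E.
Hypothesis u_ge : forall x, c0 <= u x.

(** The sign of [mixedL] turns a finite upper bound of the singular integral into one for the
    Laplacian. *)
Lemma fraclap_integral_bound x (L B : R) : Omega x -> L <= laplacian u x ->
  (integral_Rn (fun y => ((2 * u x - u (x + y) - u (x - y)) / (enorm y `^ (n%:R + 2 * s)))%R)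
     <= B%:E)%E -> L <= B / 2.
Proof.
move=> Ox Llap IB; have := Lu x Ox; rewrite /mixedL /fraclap.
set I := integral_Rn _ in IB *.
have : (2^-1%:E * I <= (B / 2)%:E)%E.
  by rewrite mulrC EFinM lee_wpmul2l// lee_fin.
move=> IB2 L0.
have : (0 <= (- laplacian u x)%:E + (B / 2)%:E)%E.
  by apply: (le_trans L0); rewrite leeD2l.
by rewrite -EFinD lee_fin; lra.
Qed.

Lemma strong_minimum_principle x : (exists z, u z <> c0) -> Omega x -> c0 < u x.
Proof.
move=> [z uz] Ox; rewrite lt_neqAle u_ge andbT eq_sym; apply/eqP => ux.
have uz0 : c0 < u z by rewrite lt_neqAle u_ge andbT eq_sym; apply/eqP.
pose m := (u z - c0) / 2.
have m0 : 0 < m by rewrite divr_gt0// subr_gt0.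
have : nbhs z [set y | c0 + m < u y].
  have h : c0 + m < u z by rewrite /m; lra.
  by have := cu z; move=> /cvgr_gt/(_ _ h).
move=> /nbhs_normP[d /= d0 H].
pose p : R := n%:R + 2 * s.
pose y0 := z - x.
(* A positive bound for the Euclidean norm on the cube around [y0]; there the numerator is at most
   [- m], so the integrand is at most - m / E^p. *)
pose E := n%:R * (`|y0| + d) + 1.
have E0 : 0 < E by rewrite ltr_wpDl// mulr_ge0// addr_ge0// ltW.
pose f y := (2 * u x - u (x + y) - u (x - y)) / (enorm y `^ p).
have fneg y : f y <= 0.
  rewrite /f mulr_le0_ge0 ?invr_ge0 ?powR_ge0// ux.
  by have := u_ge (x + y); have := u_ge (x - y); lra.
have flt : (integral_Rn f < 0)%E.
  apply: (@integral_Rn_lt0 R n f y0 (m / E `^ p) (d / 2)) => //.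
  - by rewrite divr_gt0// powR_gt0.
  - by rewrite divr_gt0.
  move=> y yy0.
  have hu : c0 + m < u (x + y).
    apply: H; rewrite /= (_ : z - (x + y) = - (y - y0)); last by rewrite opprB /y0 opprD addrA.
    by rewrite normrN (le_lt_trans yy0)// ltr_pdivrMr// ltr_pMr// ltr1n.
  have yn0 : y != 0 by apply/eqP => y00; move: hu; rewrite y00 addr0 ux; lra.
  have ny0 := enorm_gt0 _ yn0.
  have nyE : enorm y <= E.
    apply: (le_trans (enorm_le_norm y)); rewrite /E.
    apply: (@le_trans _ _ (n%:R * (`|y0| + d))); last by rewrite lerDl.
    rewrite ler_wpM2l// -[y](subrK y0) addrC (le_trans (ler_normD _ _))// lerD2l.
    by rewrite (le_trans yy0)// ler_pdivrMr// ler_pMr// ler1n.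
  have p0 : 0 <= p by rewrite addr_ge0// mulr_ge0// ltW//; case/andP: s01.
  have pp : enorm y `^ p <= E `^ p by rewrite ge0_ler_powR ?nnegrE ?enorm_ge0 ?(ltW E0).
  rewrite /f ler_pdivrMr ?powR_gt0// mulNr.
  apply: (@le_trans _ _ (- m)).
    by rewrite ux; have := u_ge (x - y); lra.
  rewrite lerN2 -mulrA ger_pMr// mulrC ler_pdivrMr ?powR_gt0// mul1r//.
have lap0 : 0 <= laplacian u x.
  have := @C2_laplacian_ge R n Omega u Du D2u oO cu C2 x (fun=> 0) Ox.
  rewrite big1//; apply => i; apply: (@filterS _ _ _ setT); last exact: filterT.
  move=> t _; rewrite mul0r ux.
  by have := u_ge (x + t *: ebasis R i); have := u_ge (x - t *: ebasis R i); lra.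
(* The integral may be -oo; then -1 serves as the real bound. *)
have [b b0 fb] : exists2 b : R, b < 0 & (integral_Rn f <= b%:E)%E.
  move: flt; case: (integral_Rn f) => [b| |]//.
    by rewrite lte_fin => b0; exists b.
  by move=> _; exists (-1); rewrite ?ltrN10// leNye.
have := fraclap_integral_bound x 0 b Ox lap0 fb; lra.
Qed.

Lemma compact_enorm_le (x0 : V) r : compact [set x | enorm (x - x0) <= r].
Proof.
apply: bounded_closed_compact.
  exists (`|x0| + r); split; first by rewrite num_real.
  move=> M hM x /= xr; apply: le_trans (ltW hM).
  rewrite -[x](subrK x0) addrC (le_trans (ler_normD _ _))// lerD2l.
  by rewrite (le_trans (norm_le_enorm _)).
apply: (@closed_comp _ _ (fun x => enorm (x - x0)) [set t | t <= r]); last exact: closed_le.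
move=> y _; apply: (@continuous_comp _ _ _ (fun y => y - x0) (@enorm R n) y); last exact: enorm_continuous.
by apply: continuousB; [exact: (fun _ => cvg_id)|exact: cst_continuous].
Qed.

(** [alpha] is fixed from [n], [C] and [rho] before [eps]: the factor eps f(x) occurs on both sides
    of the final inequality and cancels. *)
Lemma barrier_below (x0 : V) rho : (0 < n)%N -> 0 < rho -> (exists z, u z <> c0) ->
  eball x0 rho `<=` Omega ->
  exists eps alpha, 0 < eps /\ 0 < alpha /\
    forall x, eps * (gauss alpha (x - x0) - expR (- alpha * rho ^+ 2)) <= u x - c0.
Proof.
move=> n0 rho0 unt BO.
have [C [C0 kernel]] := @integral_Rn_le_kernel R n s n0 s01.
(* The 8 comes from |x - x0|^2 >= rho^2 / 4 and the factor 1/2 in [gauss_second_diff_ge]; the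
   leading 1 ensures alpha >= 1. *)
pose alpha := 1 + 8 * (2 * n%:R + C + 1) / rho ^+ 2.
have rho2 : 0 < rho ^+ 2 by rewrite exprn_gt0.
have nR : 0 <= n%:R :> R by [].
have alpha1 : 1 <= alpha by rewrite lerDl divr_ge0 ?(ltW rho2)//; lra.
have alpha0 : 0 < alpha by lra.
have alphaC : 2 * n%:R + C < alpha * rho ^+ 2 / 8.
  have -> : alpha * rho ^+ 2 / 8 = rho ^+ 2 / 8 + (2 * n%:R + C + 1).
    by rewrite /alpha; field; rewrite gt_eqF.
  by lra.
pose M := expR (- alpha * rho ^+ 2).
have M0 : 0 < M := expR_gt0 _.
pose f x := gauss alpha (x - x0).
have f0 x : 0 < f x := gauss_gt0 _ _.
have f1 x : f x <= 1.
  by rewrite /f /gauss -expR0 ler_expR mulNr oppr_le0 mulr_ge0 ?dotp_ge0// ltW.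
have fM x : rho <= enorm (x - x0) -> f x <= M.
  move=> xr; rewrite /f /gauss ler_expR !mulNr lerN2 ler_pM2l// -enorm_sqr.
  by rewrite lerXn2r// ?nnegrE ?enorm_ge0 ?(ltW rho0).
have cW (eps : R) : continuous (fun x => u x - eps * (f x - M)).
  have cf : continuous f.
    move=> x; apply: (@continuous_comp _ _ _ (fun y => y - x0) (gauss alpha) x); last exact: gauss_continuous.
    by apply: continuousB; [exact: (fun _ => cvg_id)|exact: cst_continuous].
  have cg : continuous (fun x => eps * (f x - M)).
    move=> x; apply: (@continuousM _ _ (fun=> eps) (fun x => f x - M) x); first exact: cst_continuous.
    by apply: (@continuousB _ _ _ f (fun=> M) x); [exact: cf|exact: cst_continuous].
  by move=> x; apply: (@continuousB _ _ _ u (fun x => eps * (f x - M)) x); [exact: cu|exact: cg].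
have nonempty r : 0 <= r -> [set x | enorm (x - x0) <= r] !=set0.
  by move=> r0; exists x0; rewrite /= subrr enorm0.
(* The minimum of u - c0 on the compact half ball, positive by the strong minimum principle. *)
have [eps eps0 eps_u] : exists2 eps, 0 < eps & forall x, enorm (x - x0) <= rho / 2 -> c0 + eps <= u x.
  have [||z zB zmin] := compact_EVT_min (f := u) (nonempty (rho / 2) _) (compact_enorm_le x0 (rho / 2)).
  - by rewrite divr_ge0// ltW.
  - exact: continuous_subspaceT.
  rewrite inE/= in zB.
  exists (u z - c0).
    rewrite subr_gt0; apply: strong_minimum_principle => //; apply: BO.
    by rewrite /eball/= (le_lt_trans zB)// ltr_pdivrMr// ltr_pMr// ltr1n.
  by move=> x xB; rewrite addrC subrK zmin// inE.
exists eps, alpha; split=> //; split=> // z; rewrite -/M -/(f z) leNgt; apply/negP => zlt.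
(* [W] is at least [c0] outside the ball and on the half ball, so a value below [c0] puts a global
   minimum in the annulus between. *)
pose W x := u x - eps * (f x - M).
have W_out x : rho <= enorm (x - x0) -> c0 <= W x.
  move=> /fM fx; rewrite /W; have := u_ge x.
  have : eps * (f x - M) <= 0 by rewrite pmulr_rle0// subr_le0.
  by lra.
have W_in x : enorm (x - x0) <= rho / 2 -> c0 <= W x.
  move=> /eps_u ux; rewrite /W.
  have : eps * (f x - M) <= eps by rewrite ger_pMr//; have := f1 x; lra.
  by lra.
have Wz : W z < c0 by rewrite /W; lra.
have zB : enorm (z - x0) <= rho.
  by rewrite leNgt; apply/negP => /ltW/W_out; rewrite leNgt Wz.
have [||x xB xmin] := compact_EVT_min (f := W) (nonempty rho _) (compact_enorm_le x0 rho).
- exact: ltW.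
- by apply: continuous_subspaceT; exact: cW.
have Wx : W x < c0 by rewrite (le_lt_trans _ Wz)// xmin// inE.
have Wmin y : W x <= W y.
  have [yB|yB] := leP (enorm (y - x0)) rho; first by rewrite xmin// inE.
  by rewrite (le_trans (ltW Wx))// W_out// ltW.
have xlt : enorm (x - x0) < rho.
  by rewrite ltNge; apply/negP => /W_out; rewrite leNgt Wx.
have xgt : rho / 2 < enorm (x - x0).
  by rewrite ltNge; apply/negP => /W_in; rewrite leNgt Wx.
have Ox : Omega x by apply: BO.
(* Minimality of [W] at [x] transfers second differences from [f] to [u], for both the Laplacian and
   the nonlocal term. *)
have diff y : 2 * u x - u (x + y) - u (x - y) <= eps * (2 * f x - f (x + y) - f (x - y)).
  by have := Wmin (x + y); have := Wmin (x - y); rewrite /W; lra.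
have fD y : f (x + y) = gauss alpha (x - x0 + y) by rewrite /f addrAC.
pose L i := eps * (f x * (alpha ^+ 2 * (x - x0) ord0 i ^+ 2 / 2 - 2 * alpha)).
have lapL : \sum_i L i <= laplacian u x.
  apply: (@C2_laplacian_ge R n Omega u Du D2u oO cu C2 x L Ox) => i.
  near=> t.
  have t0 : 0 < t by near: t; exact: nbhs_right_gt.
  have ta : t < (2 * alpha)^-1 by near: t; apply: nbhs_right_lt; rewrite invr_gt0 mulr_gt0.
  have at2 : alpha * t ^+ 2 <= 2^-1.
    have at1 : 2 * alpha * t < 1.
      by rewrite mulrC -ltr_pdivlMr ?mulr_gt0// mul1r.
    have t1 : t < 1.
      apply: lt_trans ta _; rewrite invf_lt1 ?mulr_gt0//; lra.
    by rewrite expr2 mulrA; nra.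
  have G := gauss_second_diff_ge alpha (x - x0) i t (ltW alpha0) at2.
  have := diff (t *: ebasis R i); rewrite !fD.
  have := ler_wpM2l (ltW eps0) G; rewrite /L /f; lra.
have intB := kernel (fun y => (2 * u x - u (x + y) - u (x - y)) / (enorm y `^ (n%:R + 2 * s)))
    (eps * (2 * f x * alpha)).
have /= := fraclap_integral_bound x _ _ Ox lapL (intB _ _).
have sumL : eps * f x * (alpha ^+ 2 * rho ^+ 2 / 8 - 2 * alpha * n%:R) <= \sum_i L i.
  have -> : \sum_i L i = eps * f x * (alpha ^+ 2 * dotp (x - x0) (x - x0) / 2 - 2 * alpha * n%:R).
    rewrite /L -mulr_sumr -mulr_sumr mulrA sumrB; congr (_ * (_ - _)).
      by rewrite -mulr_suml -mulr_sumr; congr (_ * _ * _).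
    by rewrite sumr_const card_ord mulr_natr.
  rewrite ler_pM2l ?mulr_gt0// lerD2r -[leLHS]mulrA -[leRHS]mulrA ler_pM2l ?exprn_gt0//.
  have : (rho / 2) ^+ 2 <= enorm (x - x0) ^+ 2.
    by rewrite lerXn2r// ?nnegrE ?enorm_ge0 ?(ltW xgt)// divr_ge0// ltW.
  rewrite enorm_sqr (_ : (rho / 2) ^+ 2 = rho ^+ 2 / 4); last by field.
  by move=> ?; lra.
move=> H; have : \sum_i L i <= eps * f x * (alpha * C).
  rewrite (le_trans (H _ _))//.
  - by rewrite !mulr_ge0// ?(ltW eps0) ?(ltW (f0 _)) ?(ltW alpha0).
  - move=> y; rewrite mulrA ler_wpM2r ?invr_ge0 ?powR_ge0//.
    apply: (le_trans (diff y)); rewrite -mulrA ler_pM2l// !fD.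
    exact: gauss_second_diff_le.
  - by rewrite le_eqVlt; apply/orP; left; apply/eqP; field.
move=> H2.
have : eps * f x * (alpha ^+ 2 * rho ^+ 2 / 8 - 2 * alpha * n%:R) <= eps * f x * (alpha * C).
  exact: le_trans sumL H2.
rewrite ler_pM2l ?mulr_gt0//.
have : alpha * (2 * n%:R + C) < alpha * (alpha * rho ^+ 2 / 8) by rewrite ltr_pM2l.
lra.
Unshelve. all: by end_near. Qed.

End maximum_principles.

(** * Slope at the boundary point *)

Lemma gauss_profile_ge (R : realType) (alpha rho2 q : R) :
  expR (- alpha * rho2) * (alpha * (rho2 - q)) <= expR (- alpha * q) - expR (- alpha * rho2).
Proof.
have -> : expR (- alpha * q) = expR (- alpha * rho2) * expR (alpha * (rho2 - q)).
  by rewrite -expRD; congr expR; ring.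
rewrite -[X in _ <= _ - X]mulr1 -mulrBr ler_wpM2l ?expR_ge0// lerBrDl.
exact: expR_ge1Dx.
Qed.

(** At [xi] the gradient is only the continuous extension [Du]. The mean value theorem is therefore
    used on the open inner segment, and the slope passes to [xi] by continuity of [Du] within the
    closure. *)
Lemma boundary_slope_pos (R : realType) (n : nat) (Omega : set 'rV[R]_n)
    (u : 'rV[R]_n -> R) (Du : 'I_n -> 'rV[R]_n -> R) D2u (c0 eps alpha rho : R)
    (xi x0 : 'rV[R]_n) :
  open Omega -> continuous u -> C2_closure Omega u Du D2u ->
  0 < eps -> 0 < alpha -> 0 < rho -> enorm (xi - x0) = rho -> eball x0 rho `<=` Omega ->
  closure Omega xi -> u xi = c0 ->
  (forall x, eps * (gauss alpha (x - x0) - expR (- alpha * rho ^+ 2)) <= u x - c0) ->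
  \sum_i (xi - x0) ord0 i * Du i xi < 0.
Proof.
move=> oO cu C2 eps0 alpha0 rho0 xirho BO clxi uxi ub.
pose d := x0 - xi.
pose F y := \sum_i d ord0 i * Du i y.
have -> : \sum_i (xi - x0) ord0 i * Du i xi = - F xi.
  by rewrite -sumrN; apply: eq_bigr => i _; rewrite -mulNr -opprB mxE.
rewrite oppr_lt0.
(* At xi + t d the barrier is at least t (2 - t) kappa, hence at least t kappa for 0 < t < 1. *)
pose kappa := eps * (expR (- alpha * rho ^+ 2) * (alpha * rho ^+ 2)).
have kappa0 : 0 < kappa by rewrite !mulr_gt0 ?expR_gt0// exprn_gt0.
apply: (lt_le_trans kappa0); rewrite leNgt; apply/negP => Fk.
have xid t : xi + t *: d - x0 = (1 - t) *: (xi - x0).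
  rewrite (_ : d = - (xi - x0)); last by rewrite opprB.
  by rewrite scalerN scalerBl scale1r addrAC.
have lineB t : 0 < t < 1 -> eball x0 rho (xi + t *: d).
  move=> /andP[t0 t1]; rewrite /eball/= xid enormZ xirho gtr0_norm ?subr_gt0//.
  by rewrite gtr_pMl//; lra.
have growth t : 0 < t < 1 -> t * kappa <= u (xi + t *: d) - u xi.
  move=> /andP[t0 t1]; rewrite uxi; apply: le_trans (ub _).
  have := gauss_profile_ge R alpha (rho ^+ 2) (dotp (xi + t *: d - x0) (xi + t *: d - x0)).
  rewrite -/(gauss alpha _) => /(ler_wpM2l (ltW eps0)); apply: le_trans.
  rewrite xid !(dotpZl, dotpZr) -enorm_sqr xirho /kappa.
  have -> : eps * (expR (- alpha * rho ^+ 2) * (alpha * (rho ^+ 2 - (1 - t) * ((1 - t) * rho ^+ 2)))) =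
     (t * (2 - t)) * kappa by rewrite /kappa; ring.
  by rewrite -/kappa ler_pM2r// ler_pMr//; lra.
have Fcont : within (closure Omega) (nbhs xi) [set y | F y < kappa].
  have cF : F y @[y --> within (closure Omega) (nbhs xi)] --> F xi.
    apply: cvg_big => [|i _]; first exact: add_continuous.
    apply: cvgM; first exact: cvg_cst.
    have := C2.2.2.1 i xi; rewrite /continuous_at/=.
    by rewrite nbhs_subspace_in//.
  by move: cF => /cvgr_lt/(_ kappa Fk).
have lim0 : (xi + t *: d) @[t --> (0 : R)] --> xi.
  suff : (xi + t *: d) @[t --> (0 : R)] --> xi + 0 *: d by rewrite scale0r addr0.
  by apply: cvgD; [exact: cvg_cst|apply: cvgZ; [exact: cvg_id|exact: cvg_cst]].
have : \forall t \near (0 : R), closure Omega (xi + t *: d) -> F (xi + t *: d) < kappa.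
  exact: (lim0 _ Fcont).
move=> /nbhs_normP[m /= m0 H].
pose a := Num.min (m / 2) (2^-1).
have a0 : 0 < a by rewrite lt_min divr_gt0//= invr_gt0.
have a1 : a < 1 by rewrite gt_min; apply/orP; right; lra.
have am : a < m by rewrite gt_min; apply/orP; left; lra.
have inO t : 0 < t < 1 -> Omega (xi + t *: d) by move=> /lineB/BO.
have [t /andP[t0 ta]|t [/andP[t0 ta] ut]] := @MVT_line R _ u xi d a a0 cu.
  have t01 : 0 < t < 1 by rewrite t0 (lt_trans ta).
  by have [] := @C2_is_derive_grad R n Omega u Du D2u oO cu C2 (xi + t *: d) d (inO t t01).
have t01 : 0 < t < 1 by rewrite t0 (lt_trans ta).
have [_ DF] := @C2_is_derive_grad R n Omega u Du D2u oO cu C2 (xi + t *: d) d (inO t t01).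
rewrite DF -/(F _) in ut.
have := growth a; rewrite a0 a1 ut => /(_ isT).
rewrite ler_pM2l// leNgt H//=.
  by rewrite sub0r normrN gtr0_norm// (lt_trans ta).
by apply: subset_closure; exact: inO.
Qed.

Theorem theorem2p9 (R : realType) (n : nat) (s : R) (Omega : set 'rV[R]_n)
  (c0 epsb : R) (u : 'rV[R]_n -> R)
  (Du : 'I_n -> 'rV[R]_n -> R) (D2u : 'I_n -> 'I_n -> 'rV[R]_n -> R)
  (xi nu : 'rV[R]_n) :
  0 < s < 1 ->
  open Omega ->
  (exists M : R, forall x, Omega x -> enorm x <= M) ->
  bdry_Ck 1 Omega ->
  0 < epsb < 1 ->
  continuous u ->
  (exists M : R, forall x, `|u x| <= M) ->
  C2_closure Omega u Du D2u ->
  (forall x, Omega x -> (0 <= mixedL s u x)%E) ->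
  bdry Omega xi ->
  (forall x, eball xi epsb x -> bdry Omega x -> u x = c0) ->
  (forall x, c0 <= u x) ->
  (exists x, u x <> c0) ->
  (forall p, eball xi epsb p -> bdry Omega p -> bdry_Ck_at 2 Omega p) ->
  outer_unit_normal Omega xi nu ->
  \sum_(i < n) nu ord0 i * Du i xi < 0.
Proof.
move=> s01 oO _ _ /andP[epsb0 _] cu _ C2 Lu bxi ub u_ge unt bC2 [r1 [e1 [g1 [G1 nuE]]]].
have xiB : eball xi epsb xi by rewrite /eball/= subrr enorm0.
have [r2 [e2 [g2 G2]]] := bC2 xi xiB bxi.
(* In dimension 0 no graph direction could have norm 1. *)
have n0 : (0 < n)%N.
  rewrite lt0n; apply/eqP => nz.
  have nR : n%:R = 0 :> R by rewrite nz.
  by have := enorm_le_norm e2; rewrite G2.2.1 nR mul0r ler10.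
have [x0 [rho [rho0 [xirho BO]]]] := interior_ball _ _ _ _ _ G2 (Ck_graph_value _ _ _ _ _ _ oO bxi G2).
(* The ball comes from the C^2 graph, [nu] from the C^1 graph; [nu] is a positive multiple of
   [xi - x0]. *)
have [c c_gt0 cE] := outer_normal_radial _ _ _ _ _ _ _ G1 (Ck_graph_value _ _ _ _ _ _ oO bxi G1) rho0 xirho BO.
have [eps [alpha [eps0 [alpha0 below]]]] :=
  barrier_below s c0 Omega u Du D2u s01 oO cu C2 Lu u_ge x0 rho n0 rho0 unt BO.
have slope := boundary_slope_pos _ _ _ _ _ _ _ _ _ _ _ _ oO cu C2 eps0 alpha0 rho0 xirho BO bxi.1 (ub _ xiB bxi) below.
rewrite nuE cE.
under eq_bigr do rewrite mxE -mulrA.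
by rewrite -mulr_sumr pmulr_rlt0.
Qed.
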